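(* Let $a\ge 5$, and let $f$ be the gamma density with parameter $a$, i.e. $f(x)=x^{a-1}e^{-x}/\Gamma(a)$ for $x>0$ and $f(x)=0$ for $x\le 0$. Let $x_\pm$, $A$, $p_1,\dots,p_4$ and the random variables $W,U,V,J,X_r$ be as defined in the context. Then $A<1$. Moreover, define $Y$ by $$ Y=\begin{cases} a-1+\sqrt{a-1}\left(1+\log\left(\tfrac1U\right)\left(1+\tfrac{1}{\sqrt{a-1}}\right)\right) & \text{if } J=1,\\ a-1+U\sqrt{a-1} & \text{if } J=2,\\ a-1-U\sqrt{a-1} & \text{if } J=3,\\ a-1-\sqrt{a-1}\left(1+\log\left(\tfrac1U\right)\left(1-\tfrac{1}{\sqrt{a-1}}\right)\right) & \text{if } J=4, \end{cases} $$ and let $\mathcal{E}$ be the acceptance event that $$ \begin{cases} V f(x_+)\,e^{-(Y-x_+)\sqrt{a-1}/x_+}\le f(Y) & \text{if } J=1,\\ V\,(f(a-1)-f(x_+))\le f(Y)-f(x_+) & \text{if } J=2,\\ V\,(f(a-1)-f(x_-))\le f(Y)-f(x_-) & \text{if } J=3,\\ V f(x_-)\,e^{-(x_--Y)\sqrt{a-1}/x_-}\le f(Y) & \text{if } J=4. \end{cases} $$ Put $X=Y$ if both $W\ge 1-A$ and $\mathcal{E}$ occur, and $X=X_r$ otherwise. Then the random variable $X$ has density $f$.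
   Context: Notation, for $a\ge 5$: $x_+=a-1+\sqrt{a-1}$ and $x_-=a-1-\sqrt{a-1}$ (so $x_->0$). Let $$g(x)=\frac{f(x)}{f(a-1)}=\left(\frac{x}{a-1}\right)^{a-1}e^{a-1-x},\qquad x>0,$$ $$p_1=\frac{g(x_+)x_+}{\sqrt{a-1}},\quad p_2=(g(a-1)-g(x_+))\sqrt{a-1},\quad p_3=(g(a-1)-g(x_-))\sqrt{a-1},\quad p_4=\frac{g(x_-)x_-}{\sqrt{a-1}},$$ and $p=p_1+p_2+p_3+p_4$. Let $$A=\frac{1}{\Gamma(a)}\left(\frac{a-1}{e}\right)^{a-1}\left(2\sqrt{a-1}+\psi(\sqrt{a-1})\right),\qquad \psi(x)=e^{-x}\left(1+\frac1x\right)^{x^2}-e^{x}\left(1-\frac1x\right)^{x^2}.$$ Random variables (all independent): $W,U,V$ are uniform on $[0,1]$; $J\in\{1,2,3,4\}$ has $\mathbb{P}\{J=j\}=p_j/p$; and $X_r$ is generated from two further independent uniform $[0,1]$ variables $U',V'$ by $X_r=a-1+U'\sqrt{a-1}$ if $V'\le f(x_+)/(f(x_+)+f(x_-))$, and $X_r=a-1-U'\sqrt{a-1}$ otherwise. *)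

(* Defs.v *)
From mathcomp Require Import all_boot all_order all_algebra.
From mathcomp Require Import all_classical all_reals all_analysis.

Set Implicit Arguments.
Unset Strict Implicit.
Unset Printing Implicit Defensive.

Import Order.TTheory GRing.Theory Num.Theory.
Import numFieldNormedType.Exports.

Local Open Scope classical_set_scope.
Local Open Scope ring_scope.

Section probability_notions.
Context d (T : measurableType d) (R : realType) (P : probability T R).

Definition generated_sigma_algebra d' (T' : measurableType d') (X : T -> T')
    : set (set T) :=
  preimage_set_system setT X measurable.

(* The members of s are sigma-algebras on T, given as a sequence because the
   random variables generating them may take values in different types. *)
Definition mutually_independent (s : seq (set (set T))) : Prop :=
  forall (I : {set 'I_(size s)}) (E : 'I_(size s) -> set T),
    (forall i, i \in I -> (nth set0 s i) (E i)) ->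
    P (\bigcap_(i in [set` I]) E i) = (\prod_(i in I) P (E i))%E.

(* Only measurable B are compared: the values of a measure on the other sets
   are junk. *)
Definition uniform01 (X : {RV P >-> R}) : Prop :=
  forall B : set R, measurable B ->
    distribution P X B = uniform_prob (@ltr01 R) B.

Definition has_density (X : T -> R) (f : R -> R) : Prop :=
  measurable_fun setT X /\
  forall B : set R, measurable B ->
    P (X @^-1` B) = (\int[lebesgue_measure]_(x in B) (f x)%:E)%E.

End probability_notions.

Section gamma_sampler.
Context (R : realType) (a : R).

Definition gamma_fun : R :=
  \int[lebesgue_measure]_(t in `]0, +oo[) (t `^ (a - 1) * expR (- t)).

Definition gamma_pdf (x : R) : R :=
  if 0 < x then x `^ (a - 1) * expR (- x) / gamma_fun else 0.

(* a - 1 is the mode of the gamma density. *)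
Definition sqrt_mode : R := Num.sqrt (a - 1).

Definition x_plus : R := a - 1 + sqrt_mode.
Definition x_minus : R := a - 1 - sqrt_mode.

(* For x > 0 this is (x / (a - 1)) `^ (a - 1) * expR (a - 1 - x). *)
Definition g (x : R) : R := gamma_pdf x / gamma_pdf (a - 1).

Definition p_ (j : nat) : R :=
  match j with
  | 1%N => g x_plus * x_plus / sqrt_mode
  | 2%N => (g (a - 1) - g x_plus) * sqrt_mode
  | 3%N => (g (a - 1) - g x_minus) * sqrt_mode
  | 4%N => g x_minus * x_minus / sqrt_mode
  | _ => 0
  end.

Definition p : R := p_ 1 + p_ 2 + p_ 3 + p_ 4.

Definition psi (x : R) : R :=
  expR (- x) * (1 + 1 / x) `^ (x ^+ 2) - expR x * (1 - 1 / x) `^ (x ^+ 2).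

Definition A : R :=
  1 / gamma_fun * ((a - 1) / expR 1) `^ (a - 1) * (2 * sqrt_mode + psi sqrt_mode).

Definition X_r (u' v' : R) : R :=
  if v' <= gamma_pdf x_plus / (gamma_pdf x_plus + gamma_pdf x_minus)
  then a - 1 + u' * sqrt_mode
  else a - 1 - u' * sqrt_mode.

Definition Y (j : nat) (u : R) : R :=
  match j with
  | 1%N => a - 1 + sqrt_mode * (1 + ln (1 / u) * (1 + 1 / sqrt_mode))
  | 2%N => a - 1 + u * sqrt_mode
  | 3%N => a - 1 - u * sqrt_mode
  | 4%N => a - 1 - sqrt_mode * (1 + ln (1 / u) * (1 - 1 / sqrt_mode))
  | _ => 0
  end.

Definition acceptance (j : nat) (v y : R) : bool :=
  match j with
  | 1%N => v * gamma_pdf x_plus * expR (- (y - x_plus) * sqrt_mode / x_plus)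
           <= gamma_pdf y
  | 2%N => v * (gamma_pdf (a - 1) - gamma_pdf x_plus)
           <= gamma_pdf y - gamma_pdf x_plus
  | 3%N => v * (gamma_pdf (a - 1) - gamma_pdf x_minus)
           <= gamma_pdf y - gamma_pdf x_minus
  | 4%N => v * gamma_pdf x_minus * expR (- (x_minus - y) * sqrt_mode / x_minus)
           <= gamma_pdf y
  | _ => false
  end.

Definition sampler (w u v : R) (j : nat) (u' v' : R) : R :=
  if (1 - A <= w) && acceptance j v (Y j u) then Y j u else X_r u' v'.

End gamma_sampler.

(* Main.v *)
Require Import Defs.
From mathcomp Require Import all_boot all_order all_algebra.
From mathcomp Require Import all_classical all_reals all_analysis.
From mathcomp Require Import measurable_realfun ring lra.

Set Implicit Arguments.
Unset Strict Implicit.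
Unset Printing Implicit Defensive.

Import Order.TTheory GRing.Theory Num.Theory.
Import numFieldNormedType.Exports.

Local Open Scope classical_set_scope.
Local Open Scope ring_scope.

(** Write n = a - 1, s = sqrt n and M = f n. Concavity of log f bounds f by
    exponential tails beyond x_+ and x_- and by M between them, and p is
    normalised so that p M = 2 s M + f x_+ - f x_- = A. The proposal Y is
    accepted inside B with probability (1 / A) (int_B f - S B), where S has
    density f x_+ on [n, x_+] and f x_- on [x_-, n]. The event W >= 1 - A
    contributes the factor A, and the complementary event, of probability S R,
    contributes the normalised measure S, which is the law of X_r.

    For A < 1, put phi_s t = f (n + s t) / M; one has to show that the integral
    of phi_s over t > - s exceeds 2 + (phi_s 1 - phi_s (-1)) / s. Comparing
    logarithmic derivatives in t gives phi_s t >= exp (- t^2 / 2) for t >= 0 and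
    phi_s t >= phi_2 t for t <= 0, which reduces the claim to two integrals of
    polynomials and the numerical value of exp 2. *)

(** * Changes of variables *)

(** The hypothesis a >= 5 says s >= 2, and s = 2 is the extreme case on the left: there phi_2 t = (1
    + t / 2)^4 exp (- 2 t) is smallest and elementary. On the right, phi_s stays above exp (- t^2 /
    2), its limit for large s. One numerical estimate therefore covers every a: the integral of
    phi_s is at least 2.14, while (phi_s 1 - phi_s (-1)) / s is at most 1 / 8. This margin allows
    cutting the right tail at t = 4 and replacing exponentials by polynomials. On the probabilistic
    side, independence gives product formulas on rectangles only, whereas acceptance is a curved
    region of (U, V) and [X_r] is a function of (U', V'). The acceptance events are therefore
    studied together with a rectangle in (U', V'). This yields the independence of rejection from
    that pair, and uniqueness of the product measure then passes from rectangles to all measurable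
    sets. *)

Notation pushforward_measure :=
  measure_function_pushforward__canonical__measure_function_Measure.

Section change_of_variables.
Context {R : realType}.
Local Notation mu := (@lebesgue_measure R).
Local Open Scope ereal_scope.

Lemma measurable_affine (c b : R) :
  measurable_fun setT (fun u : R => c + u * b)%R.
Proof. by apply: measurable_funD => //; exact: measurable_funM. Qed.

(** Both sides are measures in [A], so agreement on the intervals []x, y]] suffices. A negative [b]
    is allowed and turns such an interval into one closed on the left. The sampler's left pieces use
    this case. *)
Lemma lebesgue_measure_affine (c b : R) (b0 : b != 0%R) (A : set R) :
  measurable A ->
  mu A = (`|b|%:E * mu ((fun u : R => c + u * b)%R @^-1` A)).
Proof.
move=> mA; set phi := (fun u : R => c + u * b)%R.
have mphi : measurable_fun setT (phi : measurableTypeR R -> measurableTypeR R).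
  exact: measurable_affine.
pose m : {measure set (measurableTypeR R) -> \bar R} :=
  mscale (NngNum (normr_ge0 b)) (pushforward_measure mu mphi).
rewrite (@lebesgue_measure_unique R m)//= => _ [[x y]] _ <-.
rewrite /m /mscale/= /pushforward.
have [xy|yx] := ltP x y; last first.
  rewrite set_itv_ge ?bnd_simp -?leNgt// preimage_set0 !measure0 mule0//.
rewrite lebesgue_measure_itv/= lte_fin xy.
have [bp|bn] := ltP 0%R b.
  have -> : phi @^-1` `]x, y] = `]((x - c) / b)%R, ((y - c) / b)%R]%classic.
    apply/seteqP; split => u /=; rewrite !in_itv/= ltr_pdivrMr// ler_pdivlMr//.
      by rewrite /phi => /andP[? ?]; apply/andP; split; lra.
    by rewrite /phi => /andP[? ?]; apply/andP; split; lra.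
  rewrite lebesgue_measure_itv/= lte_fin ltr_pM2r ?invr_gt0// ltrD2r xy.
  rewrite gtr0_norm// -!EFinD -EFinM; congr (_%:E); field; lra.
have {}bn : (b < 0)%R by rewrite lt_neqAle b0.
have -> : phi @^-1` `]x, y] = `[((y - c) / b)%R, ((x - c) / b)%R[%classic.
  apply/seteqP; split => u /=; rewrite !in_itv/= ltr_ndivlMr// ler_ndivrMr//.
    by rewrite /phi => /andP[? ?]; apply/andP; split; lra.
  by rewrite /phi => /andP[? ?]; apply/andP; split; lra.
rewrite lebesgue_measure_itv/= lte_fin ltr_nM2r ?invr_lt0// ltrD2r xy.
rewrite ltr0_norm// -!EFinD -EFinM; congr (_%:E); field; lra.
Qed.

Lemma ge0_integral_affine (c b : R) (b0 : b != 0%R) (D : set R) (h : R -> \bar R) :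
  measurable D -> measurable_fun D h -> (forall x, D x -> 0 <= h x) ->
  \int[mu]_(x in D) h x =
  `|b|%:E * \int[mu]_(u in (fun u : R => c + u * b)%R @^-1` D) h (c + u * b)%R.
Proof.
move=> mD mh h0; set phi := (fun u : R => c + u * b)%R.
have mphi : measurable_fun setT (phi : measurableTypeR R -> measurableTypeR R).
  exact: measurable_affine.
have /= <- := @ge0_integral_pushforward _ _ _ _ _ _ mphi mu _ h mD mh; last first.
  by move=> x /[!inE]; exact: h0.
have /= <- := @ge0_integral_mscale _ _ _ (pushforward_measure mu mphi)
  D mD (NngNum (normr_ge0 b)) h mh h0.
by apply: eq_measure_integral => A mA _; exact: lebesgue_measure_affine.
Qed.

(** The Radon-Nikodym derivative of [nu] and [k] have the same integral over every measurable set.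
    They are thus equal almost everywhere, and one may replace the other under the integral. *)
Lemma ge0_integral_density (nu : {finite_measure set (measurableTypeR R) -> \bar R})
    (k : R -> R) (f : R -> \bar R) :
  measurable_fun setT k -> (forall x, 0 <= k x)%R ->
  (forall B, measurable B -> nu B = \int[mu]_(x in B) (k x)%:E) ->
  measurable_fun setT f -> (forall x, 0 <= f x) ->
  \int[nu]_x f x = \int[mu]_x (f x * (k x)%:E).
Proof.
move=> mk k0 nuE mf f0.
have mEk : measurable_fun setT (EFin \o k) by exact/measurable_EFinP.
have dom : nu `<< mu.
  apply/null_content_dominatesP => A mA A0; rewrite nuE//.
  by apply: null_set_integral => //; exact: measurable_funTS.
rewrite -(Radon_Nikodym_SigmaFinite.change_of_variables dom)//.
have mr := measurable_int _ (Radon_Nikodym_SigmaFinite.f_integrable dom).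
apply: ge0_ae_eq_integral => //.
- exact: emeasurable_funM.
- exact: emeasurable_funM.
- by move=> x _; rewrite mule_ge0// Radon_Nikodym_SigmaFinite.f_ge0.
- by move=> x _; rewrite mule_ge0// lee_fin.
apply: ae_eqe_mul2l; apply: integral_ae_eq => //.
  exact: Radon_Nikodym_SigmaFinite.f_integrable.
by move=> E _ mE; rewrite -Radon_Nikodym_SigmaFinite.f_integral// nuE.
Qed.

Lemma uniform_prob01_itv (x y : R) (b1 b2 : bool) :
  (0 <= x)%R -> (x <= y)%R -> (y <= 1)%R ->
  uniform_prob (@ltr01 R) [set` Interval (BSide b1 x) (BSide b2 y)] = (y - x)%:E.
Proof.
move=> x0 xy y1; rewrite /uniform_prob.
rewrite integral_itv_bndoo; last first.
  by apply/measurable_EFinP; apply: measurable_funTS; exact: measurable_uniform_pdf.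
rewrite (eq_integral (fun=> 1)); last first.
  move=> u; rewrite inE/= in_itv/= => /andP[xu uy].
  by rewrite /uniform_pdf subr0 invr1 (ltW (le_lt_trans x0 xu)) (ltW (lt_le_trans uy y1)).
rewrite integral_cst// mul1e/= lebesgue_measure_itv/= lte_fin -EFinD.
by case: ltP => // yx; congr EFin; lra.
Qed.

Lemma uniform_prob01_setI (A : set R) : measurable A ->
  uniform_prob (@ltr01 R) A = uniform_prob (@ltr01 R) (A `&` `[0%R, 1%R]).
Proof. by move=> mA; rewrite /uniform_prob [LHS]integral_uniform_pdf. Qed.

Lemma uniform_prob01_le (c d : R) : (0 < c)%R -> (0 <= d <= c)%R ->
  uniform_prob (@ltr01 R) [set v | (v * c <= d)%R] = (d / c)%:E.
Proof.
move=> c0 /andP[d0 dc].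
have -> : [set v | (v * c <= d)%R] = `]-oo, (d / c)%R]%classic.
  by apply/seteqP; split => v /=; rewrite in_itv/= ler_pdivlMr.
rewrite uniform_prob01_setI//.
have -> : `]-oo, (d / c)%R] `&` `[0%R, 1%R] = `[0%R, (d / c)%R]%classic.
  have dc1 : (d / c <= 1)%R by rewrite ler_pdivrMr// mul1r.
  apply/seteqP; split => v /=; rewrite !in_itv/=.
    by move=> [-> /andP[-> _]].
  by move=> /andP[-> vdc]; rewrite vdc (le_trans vdc).
by rewrite uniform_prob01_itv ?subr0// ?divr_ge0 ?(ltW c0)// ler_pdivrMr// mul1r.
Qed.

End change_of_variables.

(** * The exponential law *)

Section exponential_law.
Context {R : realType}.
Local Notation mu := (@lebesgue_measure R).
Local Open Scope ereal_scope.

(** No sign condition is required because [ln] takes the value 0 at nonpositive arguments. *)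
Lemma ln_div1 (x : R) : ln (1 / x) = (- ln x)%R.
Proof.
rewrite div1r; have [x0|x0] := ltP 0%R x; first by rewrite lnV.
by rewrite !ln0 ?invr_le0// oppr0.
Qed.

Lemma exponential_prob1_itvcy (x : R) : (0 <= x)%R ->
  exponential_prob 1%R `[x, +oo[ = (expR (- x))%:E.
Proof.
move=> x0; rewrite /exponential_prob.
have cexp : continuous (fun z : R => - expR (- 1 * z))%R.
  move=> z; apply: cvgN; apply: continuous_comp; last exact: continuous_expR.
  by apply: continuousM => //; apply: (@continuousN _ R^o); exact: cst_continuous.
rewrite (@ge0_continuous_FTC2y _ _ (fun z => - expR (- 1 * z))%R _ 0%R)//.
- by rewrite add0e -EFinN opprK mulN1r.
- by move=> z _; exact: exponential_pdf_ge0.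
- apply: (@continuous_subspaceW R^o _ _ [set` `[0%R, +oo[]); last first.
    exact: within_continuous_exponential_pdf.
  by move=> z /=; rewrite !in_itv/= !andbT; exact: le_trans.
- rewrite -oppr0; apply: cvgN.
  under eq_fun do rewrite mulN1r; exact: cvgr_expR.
- by apply/cvg_at_right_filter; exact: cexp.
- move=> z; rewrite in_itv/= andbT => xz; apply: derive1_exponential_pdf.
  by rewrite in_itv/= andbT (le_lt_trans x0).
Qed.

(** Inverse transform sampling: the two laws are compared on the rays [[x, +oo[], which are stable
    under intersection and generate the Borel sets. *)
Lemma uniform_ln_exponential (B : set R) : measurable B ->
  uniform_prob (@ltr01 R) ((fun u : R => - ln u)%R @^-1` B) =
  exponential_prob 1%R B.
Proof.
move=> mB.
have mln : measurable_fun setT ((fun u => - ln u)%R : measurableTypeR R -> measurableTypeR R).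
  by apply: measurable_funN; exact: measurable_ln.
pose E := exponential_distribution_exponential_prob__canonical__probability_measure_Probability
  (@ltr01 R).
pose m1 := pushforward_measure (uniform_prob (@ltr01 R)) mln.
suff: m1 B = E B by [].
apply: (@measure_unique _ R (measurableTypeR R) (@RGenCInfty.G R)
  (fun k => `[(- k%:R)%R, +oo[%classic)) => //.
- exact: RGenCInfty.measurableE.
- move=> _ _ [x ->] [y ->]; exists (Num.max x y).
  by apply/seteqP; split => z /=; rewrite !in_itv/= !andbT ge_max => /andP.
- by move=> k; exists (- k%:R)%R.
- apply/seteqP; split => // x _; exists (Num.bound `|x|) => //=.
  rewrite in_itv/= andbT lerNl (le_trans (ler_norm _))// normrN.
  by rewrite ltW// (archi_boundP (normr_ge0 _)).
- move=> _ [x ->] /=.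
  have mP : measurable ((fun u : R => - ln u)%R @^-1` `[x, +oo[).
    by rewrite -[X in measurable X]setTI; apply: (mln _).
  rewrite /pushforward uniform_prob01_setI//.
  have [x0|x0] := leP x 0%R.
    have -> : (fun u : R => - ln u)%R @^-1` `[x, +oo[ `&` `[0%R, 1%R] = `[0%R, 1%R]%classic.
      apply/seteqP; split => u /=; rewrite !in_itv/= ?andbT; first by case.
      move=> /andP[u0 u1]; rewrite u0 u1; split => //.
      by rewrite (le_trans x0)// oppr_ge0 ln_le0.
    rewrite uniform_prob01_itv// subr0.
    (* For x <= 0 the ray contains [[0, +oo[], which already has mass exp 0 = 1. *)
    apply/eqP; rewrite eq_le; apply/andP; split; last exact: (@probability_le1 _ _ _ E).
    rewrite -[X in X%:E]expR0 -[X in expR X]oppr0 -exponential_prob1_itvcy//.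
    apply: (@le_measure _ _ _ E); rewrite ?inE//.
    by move=> z /=; rewrite !in_itv/= !andbT; exact: le_trans.
  have -> : (fun u : R => - ln u)%R @^-1` `[x, +oo[ `&` `[0%R, 1%R] =
      `]0%R, (expR (- x))]%classic.
    apply/seteqP; split => u /=; rewrite !in_itv/= ?andbT.
      (* The point u = 0 is excluded since [ln 0 = 0] is a default value and x > 0; hence the
         interval open at 0. *)
      move=> [xu /andP[]]; rewrite le_eqVlt => /predU1P[u0|u0 u1].
        by move: xu; rewrite -u0 ln0// oppr0 leNgt x0.
      by rewrite u0/= -ler_ln ?posrE ?expR_gt0// expRK lerNr.
    move=> /andP[u0 ux]; rewrite (ltW u0) (le_trans ux) ?andbT//; last first.
      by rewrite -expR0 ler_expR oppr_le0 ltW.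
    by split => //; rewrite lerNr -ler_expR lnK.
  rewrite uniform_prob01_itv ?expR_ge0//; last by rewrite -expR0 ler_expR oppr_le0 ltW.
  by rewrite subr0 exponential_prob1_itvcy// ltW.
- by move=> k; rewrite (@le_lt_trans _ _ 1)// ?ltry//= /pushforward probability_le1//
    -[X in measurable X]setTI; apply: (mln _).
Qed.

Lemma integral_uniform_ln (h : R -> \bar R) :
  measurable_fun setT h -> (forall x, 0 <= h x) ->
  \int[uniform_prob (@ltr01 R)]_u h (- ln u)%R =
  \int[mu]_(e in `[0%R, +oo[) (h e * (expR (- e))%:E).
Proof.
move=> mh h0.
have mln : measurable_fun setT ((fun u => - ln u)%R : measurableTypeR R -> measurableTypeR R).
  by apply: measurable_funN; exact: measurable_ln.
pose E := exponential_distribution_exponential_prob__canonical__probability_measure_Probability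
  (@ltr01 R).
have /= <- := @ge0_integral_pushforward _ _ _ _ _ _ mln (uniform_prob (@ltr01 R)) setT h
  measurableT mh (fun x _ => h0 x).
rewrite (@eq_measure_integral _ _ _ _ E)//; last first.
  by move=> A mA _; exact: uniform_ln_exponential.
rewrite (@ge0_integral_density _ E (exponential_pdf 1))//; last 2 first.
- exact: measurable_exponential_pdf.
- by move=> x; exact: exponential_pdf_ge0.
rewrite [RHS]integral_mkcond; apply: eq_integral => x _.
rewrite /exponential_pdf !patchE; case: ifPn => _; last by rewrite mule0.
by rewrite mul1r mulN1r.
Qed.

End exponential_law.

(** * Elementary bounds *)

Section elementary_bounds.
Context {R : realType}.
Local Notation mu := (@lebesgue_measure R).

Lemma expR_ge_taylor5 (x : R) : 0 <= x ->
  1 + x + x ^+ 2 / 2 + x ^+ 3 / 6 + x ^+ 4 / 24 + x ^+ 5 / 120 <= expR x.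
Proof.
move=> x0.
have -> : 1 + x + x ^+ 2 / 2 + x ^+ 3 / 6 + x ^+ 4 / 24 + x ^+ 5 / 120 =
    series (exp_coeff x) 6%N.
  rewrite /series/= !big_nat_recr//= big_geq// /exp_coeff/= !factS fact0 !muln1.
  by field.
apply: nondecreasing_cvgn_le; last exact: is_cvg_series_exp_coeff.
by apply: nondecreasing_series => n _ _; exact: exp_coeff_ge0.
Qed.

(** With the antiderivative given as a formal polynomial, differentiation and evaluation become
    rewriting. *)
Lemma integral_deriv_poly (p : {poly R}) (x y : R) : x < y ->
  (\int[mu]_(t in `[x, y]) (p^`().[t])%:E = (p.[y] - p.[x])%:E)%E.
Proof.
move=> xy; rewrite (@continuous_FTC2 _ _ (horner p))// ?EFinB//.
- by apply: continuous_subspaceT => t; exact: continuous_horner.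
- by split; [move=> t _; exact: derivable_horner |
    apply: cvg_at_right_filter; exact: continuous_horner |
    apply: cvg_at_left_filter; exact: continuous_horner].
- by move=> t _; rewrite -derivE.
Qed.

(* The logarithm of phi_s(t) = f (a - 1 + s t) / f (a - 1), where s^2 = a - 1. *)
Definition log_ratio (s t : R) : R := s ^+ 2 * ln (1 + t / s) - s * t.

Lemma is_derive_log_ratio (s t : R) : 0 < s -> 0 < s + t ->
  is_derive t 1 (log_ratio s) (- (s * t / (s + t))).
Proof.
move=> s0 st0.
have st1 : 0 < 1 + t / s by rewrite (_ : 1 + t / s = (s + t) / s) ?divr_gt0//; field; lra.
have dln := is_derive1_ln st1.
have din : is_derive t 1 (fun t => 1 + t / s) s^-1.
  by apply: is_derive_eq; rewrite /GRing.scale/=; lra.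
have dc := @is_derive1_comp _ (@ln R) (fun t => 1 + t / s) t _ _ dln din.
have -> : log_ratio s = (fun t => s ^+ 2 * (@ln R \o (fun t => 1 + t / s)) t - s * t) by [].
apply: is_derive_eq; rewrite /GRing.scale/=; field; rewrite gt_eqF//=; lra.
Qed.

Lemma log_ratio0 (s : R) : log_ratio s 0 = 0.
Proof. by rewrite /log_ratio mul0r addr0 ln1 !mulr0 subrr. Qed.

(** The difference [log_ratio 2 - log_ratio s] vanishes at 0 and is nondecreasing, since the
    numerator of its derivative is x^2 (s - 2). *)
Lemma log_ratio_cmp2 (s t : R) : 2 <= s -> -2 < t ->
  if 0 <= t then log_ratio s t <= log_ratio 2 t else log_ratio 2 t <= log_ratio s t.
Proof.
move=> s2 t2.
have d (x : R) : -2 < x -> is_derive x 1 (log_ratio 2 - log_ratio s)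
    (x ^+ 2 * (s - 2) / ((s + x) * (2 + x))).
  move=> x0.
  have d1 := @is_derive_log_ratio 2 x ltac:(lra) ltac:(lra).
  have d2 := @is_derive_log_ratio s x ltac:(lra) ltac:(lra).
  apply: is_derive_eq; field.
  by apply/andP; split; rewrite gt_eqF//; lra.
have d0 (x : R) : -2 < x -> 0 <= (log_ratio 2 - log_ratio s)^`()%classic x.
  move=> x0; rewrite derive1E (@derive_val _ _ _ _ _ _ _ (d x x0)).
  by rewrite divr_ge0// mulr_ge0 ?sqr_ge0//; lra.
have dd (x : R) : -2 < x -> derivable (log_ratio 2 - log_ratio s) x 1.
  by move=> x0; have [] := d x x0.
have mono (x y : R) : -2 < x -> x <= y ->
    (log_ratio 2 - log_ratio s) x <= (log_ratio 2 - log_ratio s) y.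
  move=> x0 xy.
  apply: (@ger0_derive1_ndecr R (log_ratio 2 - log_ratio s) x y _ _ _ x y
    (lexx x) xy (lexx y)).
  - by move=> z; rewrite in_itv/= => /andP[xz _]; apply: dd; exact: lt_trans xz.
  - by move=> z; rewrite in_itv/= => /andP[xz _]; apply: d0; exact: lt_trans xz.
  - apply: derivable_within_continuous => z; rewrite in_itv/= => /andP[xz _].
    by apply: dd; exact: lt_le_trans xz.
case: ifPn => [t0|]; last first.
  rewrite -ltNge => t0; have := mono t 0 t2 (ltW t0).
  by rewrite !fctE !log_ratio0 subrr subr_le0.
have := mono 0 t ltac:(lra) t0.
by rewrite !fctE !log_ratio0 subrr subr_ge0.
Qed.

(** Adding x^2 / 2 gives a function that vanishes at 0 and has derivative x - s x / (s + x) = x^2 /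
    (s + x). *)
Lemma log_ratio_ge_gauss (s t : R) : 0 < s -> 0 <= t -> - (t ^+ 2 / 2) <= log_ratio s t.
Proof.
move=> s0 t0; rewrite -subr_ge0.
pose q (x : R) := x ^+ 2 / 2.
have d (x : R) : 0 <= x -> is_derive x 1 (log_ratio s + q) (x ^+ 2 / (s + x)).
  move=> x0.
  have d1 := @is_derive_log_ratio s x s0 ltac:(lra).
  have d2 : is_derive x 1 q x by apply: is_derive_eq; rewrite /GRing.scale/=; field.
  by apply: is_derive_eq; field; rewrite gt_eqF//; lra.
have dd (x : R) : 0 <= x -> derivable (log_ratio s + q) x 1.
  by move=> x0; have [] := d x x0.
have : (log_ratio s + q) 0 <= (log_ratio s + q) t.
  apply: (@ger0_derive1_ndecr R (log_ratio s + q) 0 t _ _ _ 0 t (lexx 0) t0 (lexx t)).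
  - by move=> z; rewrite in_itv/= => /andP[xz _]; apply: dd; exact: ltW xz.
  - move=> z; rewrite in_itv/= => /andP[/ltW xz _].
    by rewrite derive1E (@derive_val _ _ _ _ _ _ _ (d z xz)) divr_ge0 ?sqr_ge0//; lra.
  - apply: derivable_within_continuous => z; rewrite in_itv/= => /andP[xz _].
    exact: dd.
by rewrite !fctE log_ratio0 /q; lra.
Qed.

(** With t = 4 w, exp (- t^2 / 2) = exp (- w^2)^8, and exp (- w^2) >= 1 - w^2. The result is a
    polynomial bound on 0 <= t <= 4. *)
Lemma ratio_ge_right (s w : R) : 2 <= s -> 0 <= w <= 1 ->
  (1 - w ^+ 2) ^+ 8 <= expR (log_ratio s (4 * w)).
Proof.
move=> s2 /andP[w0 w1].
rewrite (@le_trans _ _ (expR (- w ^+ 2) ^+ 8))//.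
  rewrite ler_pXn2r ?nnegrE ?expR_ge0// ?subr_ge0 ?exprn_ile1//.
  by rewrite expR_ge1Dx.
rewrite -expRM_natl ler_expR.
by have := @log_ratio_ge_gauss s (4 * w) ltac:(lra) ltac:(lra); lra.
Qed.

(** With t = - 2 w, phi_2 t = (1 - w)^4 exp (4 w); the second factor is replaced by its Taylor
    polynomial. *)
Lemma ratio_ge_left (s w : R) : 2 <= s -> 0 <= w < 1 ->
  (1 - w) ^+ 4 * (1 + 4 * w + (4 * w) ^+ 2 / 2 + (4 * w) ^+ 3 / 6
                  + (4 * w) ^+ 4 / 24 + (4 * w) ^+ 5 / 120)
  <= expR (log_ratio s (- (2 * w))).
Proof.
move=> s2 /andP[w0 w1].
rewrite (@le_trans _ _ (expR (log_ratio 2 (- (2 * w)))))//; last first.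
  rewrite ler_expR; have := @log_ratio_cmp2 s (- (2 * w)) s2 ltac:(lra).
  case: ifPn => // h; have -> : w = 0 by lra.
  by rewrite mulr0 oppr0 !log_ratio0.
rewrite /log_ratio (_ : 1 + - (2 * w) / 2 = 1 - w); last by field.
rewrite (_ : 2 ^+ 2 * ln (1 - w) - 2 * - (2 * w) = 4%:R * ln (1 - w) + 4 * w); last first.
  by ring.
rewrite expRD expRM_natl lnK ?posrE ?subr_gt0//.
by rewrite ler_wpM2l ?exprn_ge0 ?subr_ge0 ?(ltW w1)// expR_ge_taylor5//; lra.
Qed.

Lemma integral_right :
  (\int[mu]_(w in `[0%R, 1%R]) ((1 - w ^+ 2) ^+ 8)%:E = ((128 * 256) / (221 * 495))%:E :> \bar R)%E.
Proof.
(* Termwise antiderivative of the binomial expansion. It vanishes at 0, and its value at 1 is the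
   Wallis quotient 16!! / 17!!. *)
pose p : {poly R} := 'X - (8 / 3) *: 'X^3 + (28 / 5) *: 'X^5 - 8 *: 'X^7
  + (70 / 9) *: 'X^9 - (56 / 11) *: 'X^11 + (28 / 13) *: 'X^13
  - (8 / 15) *: 'X^15 + (1 / 17) *: 'X^17.
under eq_integral => w _.
  rewrite (_ : (1 - w ^+ 2) ^+ 8 = p^`().[w]); last first.
    rewrite /p !(derivD, derivB, derivN, derivZ, derivXn, derivX, hornerD, hornerN,
      hornerZ, hornerMn, hornerXn, hornerC)/=.
    by field.
  over.
rewrite integral_deriv_poly// /p !(hornerD, hornerN, hornerZ, hornerX, hornerXn).
by congr (_%:E); field.
Qed.

Lemma integral_left :
  (\int[mu]_(w in `[0%R, 1%R]) ((1 - w) ^+ 4 * (1 + 4 * w + (4 * w) ^+ 2 / 2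
    + (4 * w) ^+ 3 / 6 + (4 * w) ^+ 4 / 24 + (4 * w) ^+ 5 / 120))%:E
   = ((17 * 131) / (45 * 105))%:E :> \bar R)%E.
Proof.
(* Antiderivative of the expanded product, vanishing at 0. The square is absent because (1 - w)^4
   exp (4 w) has no linear term. *)
pose p : {poly R} := (1 / 1) *: 'X^1 - (2 / 3) *: 'X^3 - (1 / 3) *: 'X^4
  + (1 / 5) *: 'X^5 + (14 / 45) *: 'X^6 - (24 / 35) *: 'X^7 + (12 / 5) *: 'X^8
  - (352 / 135) *: 'X^9 + (64 / 75) *: 'X^10.
under eq_integral => w _.
  rewrite (_ : (1 - w) ^+ 4 * _ = p^`().[w]); last first.
    rewrite /p !(derivD, derivB, derivN, derivZ, derivXn, derivX, hornerD, hornerN,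
      hornerZ, hornerMn, hornerXn, hornerC)/=.
    by field.
  over.
rewrite integral_deriv_poly// /p !(hornerD, hornerN, hornerZ, hornerX, hornerXn).
by congr (_%:E); field.
Qed.

Lemma expR2_ge : 109 / 15 <= expR 2 :> R.
Proof. by apply: (le_trans _ (expR_ge_taylor5 _)); lra. Qed.

(** By comparison with s = 2 the left side is at most (3 / 2)^4 exp (- 2) - exp 2 / 16. With exp 2
    >= 109 / 15 this is below 0.243, hence below 2 / 8. *)
Lemma ratio_gap (s : R) : 2 <= s ->
  expR (log_ratio s 1) - expR (log_ratio s (-1)) <= s * (1 / 8).
Proof.
move=> s2.
have h1 : log_ratio s 1 <= log_ratio 2 1.
  by have := @log_ratio_cmp2 s 1 s2 ltac:(lra); rewrite ler01.
have h2 : log_ratio 2 (-1) <= log_ratio s (-1).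
  have := @log_ratio_cmp2 s (-1) s2 ltac:(lra).
  by rewrite ifF//; apply/negbTE; rewrite -ltNge; lra.
move: h1; rewrite -ler_expR => h1; move: h2; rewrite -ler_expR; move: h1.
have -> : expR (log_ratio 2 1) = (3 / 2) ^+ 4 / expR 2.
  rewrite (_ : log_ratio 2 1 = 4%:R * ln (3 / 2 : R) - 2).
    by rewrite expRD expRM_natl lnK ?posrE ?divr_gt0// expRN.
  by rewrite /log_ratio (_ : 1 + 1 / 2 = 3 / 2 :> R); [ring|field].
have -> : expR (log_ratio 2 (-1)) = 2^-1 ^+ 4 * expR 2.
  rewrite (_ : log_ratio 2 (-1) = 4%:R * ln (2^-1 : R) + 2).
    by rewrite expRD expRM_natl lnK ?posrE ?invr_gt0.
  by rewrite /log_ratio (_ : 1 + -1 / 2 = 2^-1 :> R); [ring|field].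
move=> h1 h2.
have E := expR2_ge; set e := expR 2 in E h1 h2 *.
have e0 : 0 < e by apply: lt_le_trans E; lra.
have : e^-1 <= 15 / 109 by rewrite -[leRHS]invrK lef_pV2 ?posrE ?invr_gt0//; lra.
move=> ei; apply: (@le_trans _ _ ((3 / 2) ^+ 4 / e - 2^-1 ^+ 4 * e)); first exact: lerB.
lra.
Qed.
End elementary_bounds.

(** * The gamma kernel *)

Section gamma_kernel.
Context {R : realType} (a : R) (ha : 5 <= a).
Local Notation mu := (@lebesgue_measure R).
Local Notation s := (sqrt_mode a).
Local Notation n := (a - 1).

(** The unnormalised density, so that estimates can precede the proof that [gamma_fun a] is positive
    and is a finite integral. *)
Definition gamma_ker (x : R) : R := if 0 < x then x `^ n * expR (- x) else 0.
Local Notation K := gamma_ker.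

Lemma gamma_pdfE (x : R) : gamma_pdf a x = K x / gamma_fun a.
Proof. by rewrite /gamma_pdf /K; case: ifP => // _; rewrite mul0r. Qed.

Lemma mode_ge4 : 4 <= n.
Proof. by rewrite lerBrDr (_ : 4 + 1 = 5)//; ring. Qed.

Lemma sqrt_mode_sqr : s ^+ 2 = n.
Proof. by rewrite sqr_sqrtr//; have := mode_ge4; lra. Qed.

Lemma sqrt_mode_ge2 : 2 <= s.
Proof.
rewrite -(@ler_pXn2r _ 2%N)// ?nnegrE ?sqrtr_ge0//.
by rewrite sqrt_mode_sqr; have := mode_ge4; lra.
Qed.

Lemma gamma_kerE (x : R) : 0 < x -> K x = expR (n * ln x - x).
Proof. by move=> x0; rewrite /K x0 /powR gt_eqF// expRD. Qed.

Lemma gamma_ker_gt0 (x : R) : 0 < x -> 0 < K x.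
Proof. by move=> x0; rewrite gamma_kerE// expR_gt0. Qed.

Lemma gamma_ker_ge0 (x : R) : 0 <= K x.
Proof. by have [x0|x0] := ltP 0 x; [exact/ltW/gamma_ker_gt0|rewrite /K ltNge x0]. Qed.

Lemma measurable_gamma_ker : measurable_fun setT K.
Proof.
apply: measurable_fun_ifT => //.
  exact: measurable_fun_ltr.
apply: measurable_funM; first exact: measurable_powR.
by apply: measurableT_comp => //; exact: measurable_funN.
Qed.

(* The tangent line of the concave function log f at x0 lies above its graph. *)
Lemma gamma_ker_tangent (x0 x : R) : 0 < x0 ->
  K x <= K x0 * expR ((x - x0) * (n / x0 - 1)).
Proof.
have n4 := mode_ge4; move=> x00; have [x_gt0|x_le0] := ltP 0 x; last first.
  by rewrite {1}/K ltNge x_le0 mulr_ge0 ?gamma_ker_ge0 ?expR_ge0.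
rewrite !gamma_kerE// -expRD ler_expR.
have l : ln x - ln x0 <= x / x0 - 1.
  rewrite -ln_div ?posrE// (_ : x / x0 = 1 + (x / x0 - 1)); last by ring.
  rewrite [leRHS](_ : _ = x / x0 - 1); last by ring.
  by apply: le_ln1Dx; have := divr_gt0 x_gt0 x00; lra.
have : n * (ln x - ln x0) <= n * (x / x0 - 1) by rewrite ler_wpM2l//; lra.
have -> : (x - x0) * (n / x0 - 1) = n * (x / x0 - 1) - x + x0 by field; lra.
lra.
Qed.

Lemma integral_gamma_ker_lty : (\int[mu]_x (K x)%:E < +oo)%E.
Proof.
have n0 : 0 < n by have := mode_ge4; lra.
(* The tangent at 2 n has slope n / (2 n) - 1 = - 1 / 2, which gives an exponential majorant of rate
   1 / 2. The final factor 2 cancels the normalisation of its density. *)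
pose C := K (2 * n) * expR n * 2.
have C0 : 0 <= C by rewrite !mulr_ge0 ?gamma_ker_ge0 ?expR_ge0.
have r0 : (0 : R) < 2^-1 by rewrite invr_gt0.
apply: (@le_lt_trans _ _ (\int[mu]_x (C%:E * (exponential_pdf 2^-1 x)%:E))%E).
  apply: ge0_le_integral => //=.
  - by move=> x _; rewrite lee_fin gamma_ker_ge0.
  - by apply/measurable_EFinP; exact: measurable_gamma_ker.
  - apply: measurable_funeM; apply/measurable_EFinP; exact: measurable_exponential_pdf.
  - move=> x _; rewrite -EFinM lee_fin; have [x0|x0] := leP 0 x; last first.
      by rewrite /K ltNge (ltW x0) mulr_ge0// exponential_pdf_ge0// ltW.
    rewrite exponential_pdfE// (le_trans (@gamma_ker_tangent (2 * n) x _))//; first lra.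
    have -> : (x - 2 * n) * (n / (2 * n) - 1) = n + (- 2^-1 * x) by field; lra.
    by rewrite expRD /C; lra.
rewrite ge0_integralZl//=.
- by rewrite integral_exponential_pdf// mule1 ltry.
- by apply/measurable_EFinP; exact: measurable_exponential_pdf.
- by move=> x _; rewrite lee_fin exponential_pdf_ge0// ltW.
Qed.

(** [gamma_fun] is the real part [fine] of an extended integral, so the equality rests on
    finiteness. *)
Lemma integral_gamma_ker : (\int[mu]_x (K x)%:E = (gamma_fun a)%:E)%E.
Proof.
have mK : measurable_fun setT (EFin \o K) by apply/measurable_EFinP; exact: measurable_gamma_ker.
have E : (\int[mu]_x (K x)%:E = \int[mu]_(x in `]0%R, +oo[) (x `^ n * expR (- x))%:E)%E.
  rewrite [RHS]integral_mkcond; apply: eq_integral => x _.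
  rewrite patchE /K; case: ifPn => x0; case: ifPn => //.
    by rewrite notin_setE/= in_itv/= x0.
  by rewrite inE/= in_itv/= (negbTE x0).
rewrite /gamma_fun /Rintegral -E fineK// ge0_fin_numE ?integral_gamma_ker_lty//.
by apply: integral_ge0 => x _; rewrite lee_fin gamma_ker_ge0.
Qed.

Lemma gamma_ker_ratio (t : R) : 0 < s + t ->
  K (n + s * t) = K n * expR (log_ratio s t).
Proof.
have s2 := sqrt_mode_ge2; move=> st0.
have st1 : 0 < 1 + t / s by rewrite (_ : 1 + t / s = (s + t) / s) ?divr_gt0//; [lra|field; lra].
have nE := sqrt_mode_sqr; have n0 : 0 < n by have := mode_ge4; lra.
have E : n + s * t = n * (1 + t / s) by rewrite -nE; field; lra.
rewrite !gamma_kerE//; last by rewrite E mulr_gt0.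
by rewrite -expRD; congr expR; rewrite {1}E lnM ?posrE// /log_ratio nE; ring.
Qed.

(** Substitution x = n + s b w with Jacobian s |b|, used with b = 4 to the right of the mode and b =
    - 2 to the left. *)
Lemma integral_gamma_ker_ge (D : set R) (b c : R) (q : R -> R) :
  measurable D -> b != 0 -> measurable_fun setT q ->
  (\int[mu]_(w in `[0%R, 1%R]) (q w)%:E = c%:E)%E ->
  (forall w, 0 < w < 1 -> [/\ D (n + w * (s * b)), 0 < s + b * w,
     0 <= q w & q w <= expR (log_ratio s (b * w))]) ->
  ((s * `|b| * (K n * c))%:E <= \int[mu]_(x in D) (K x)%:E)%E.
Proof.
move=> mD b0 mq qc h; have s2 := sqrt_mode_ge2.
have s0 : 0 < s by lra.
have mK : measurable_fun setT (EFin \o K) by apply/measurable_EFinP; exact: measurable_gamma_ker.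
have sb0 : s * b != 0 by rewrite mulf_neq0// gt_eqF.
have mphi := @measurable_affine R n (s * b).
have mpre : measurable ((fun u : R => n + u * (s * b)) @^-1` D).
  by rewrite -[X in measurable X]setTI; exact: mphi.
have mKphi : measurable_fun setT (fun u : R => (K (n + u * (s * b)))%:E).
  by apply: (measurableT_comp mK).
rewrite (@ge0_integral_affine _ n _ sb0)//; last 2 first.
- exact: measurable_funTS.
- by move=> x _; rewrite lee_fin gamma_ker_ge0.
rewrite normrM (gtr0_norm s0) EFinM lee_pmul2l//; last first.
  by rewrite lte_fin mulr_gt0// normr_gt0.
(* The open interval avoids w = 1, where s + b w vanishes if s = 2 and b = - 2. *)
rewrite (@le_trans _ _ (\int[mu]_(u in `]0%R, 1%R[) (K (n + u * (s * b)))%:E)%E)//; last first.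
  apply: ge0_subset_integral => //.
  - exact: measurable_funTS.
  - by move=> x _; rewrite lee_fin gamma_ker_ge0.
  - by move=> w /=; rewrite in_itv/= => /h[].
have -> : ((K n * c)%:E = \int[mu]_(u in `]0%R, 1%R[) (K n * q u)%:E)%E.
  rewrite EFinM -qc integral_itv_bndoo; last first.
    by apply/measurable_EFinP; exact: measurable_funTS.
  under [RHS]eq_integral do rewrite EFinM.
  rewrite ge0_integralZl//.
  - by apply/measurable_EFinP; exact: measurable_funTS.
  - by move=> w /=; rewrite in_itv/= lee_fin => /h[].
  - by rewrite lee_fin gamma_ker_ge0.
apply: ge0_le_integral => //.
- by move=> w /=; rewrite in_itv/= lee_fin => /h[_ _ q0 _]; rewrite mulr_ge0// gamma_ker_ge0.
- by apply/measurable_EFinP; apply: measurable_funTS; exact: measurable_funM.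
- exact: measurable_funTS.
- move=> w /=; rewrite in_itv/= lee_fin => /h[_ w0 q0 qle].
  rewrite (_ : w * (s * b) = s * (b * w)); last by ring.
  by rewrite gamma_ker_ratio// ler_wpM2l// gamma_ker_ge0.
Qed.

(** The factors 4 and 2 are the Jacobians |b| of the two sides. The bracket is about 2.1408, to be
    compared with 2 + 1 / 8. *)
Lemma gamma_fun_ge :
  K n * s * (4 * ((128 * 256) / (221 * 495)) + 2 * ((17 * 131) / (45 * 105)))
  <= gamma_fun a.
Proof.
have s2 := sqrt_mode_ge2.
have mK : measurable_fun setT (EFin \o K) by apply/measurable_EFinP; exact: measurable_gamma_ker.
have mq (q : R -> R) : (forall w, derivable q w 1) -> measurable_fun setT q.
  move=> dq; apply: continuous_measurable_fun => w.
  exact/differentiable_continuous/derivable1_diffP.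
have left_part : ((s * `|-2| * (K n * ((17 * 131) / (45 * 105))))%:E <=
    \int[mu]_(x in `]-oo, n[) (K x)%:E)%E.
  apply: (integral_gamma_ker_ge _ _ _ integral_left) => [//||//|w /andP[w0 w1]].
  - by rewrite oppr_eq0.
  - by apply: mq => w; exact: ex_derive.
  - have sw : 0 < s * w by rewrite mulr_gt0//; lra.
    rewrite /= in_itv/= mulNr; split; [lra|lra| |by rewrite ratio_ge_left// (ltW w0)].
    have w4 : 0 <= 4 * w by lra.
    rewrite mulr_ge0 ?exprn_ge0 ?subr_ge0 ?(ltW w1)//.
    have e (k : nat) : 0 <= (4 * w) ^+ k by exact: exprn_ge0.
    by have := e 2%N; have := e 3%N; have := e 4%N; have := e 5%N; lra.
have right_part : ((s * `|4| * (K n * ((128 * 256) / (221 * 495))))%:E <=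
    \int[mu]_(x in `[n, +oo[) (K x)%:E)%E.
  apply: (integral_gamma_ker_ge _ _ _ integral_right) => [//|//||w /andP[w0 w1]].
  - by apply: mq => w; exact: ex_derive.
  - have sw : 0 < s * w by rewrite mulr_gt0//; lra.
    rewrite /= in_itv/= andbT; split; [lra|lra| |by rewrite ratio_ge_right// (ltW w0) ltW].
    by rewrite exprn_even_ge0.
move: left_part right_part; rewrite normrN !gtr0_norm// => left_part right_part.
rewrite -lee_fin -integral_gamma_ker -(setUv `]-oo, n[) ge0_integral_setU//=; last 4 first.
- exact: measurableC.
- by rewrite setUv.
- by move=> x _; rewrite lee_fin gamma_ker_ge0.
- exact/disj_setPCl.
rewrite setCitvl; apply: le_trans (leeD left_part right_part).
by rewrite -EFinD lee_fin; lra.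
Qed.

Lemma gamma_fun_gt0 : 0 < gamma_fun a.
Proof.
have s2 := sqrt_mode_ge2; have n4 := mode_ge4.
apply: lt_le_trans gamma_fun_ge; apply: mulr_gt0; last by lra.
by rewrite mulr_gt0 ?gamma_ker_gt0//; lra.
Qed.

Local Notation F := (gamma_pdf a).

Lemma gamma_pdf_x_plus : F (x_plus a) = F n * expR (log_ratio s 1).
Proof.
have s2 := sqrt_mode_ge2.
have -> : x_plus a = n + s * 1 by rewrite mulr1.
rewrite (gamma_pdfE (n + s * 1)) (gamma_pdfE n) gamma_ker_ratio; last by lra.
exact: mulrAC.
Qed.

Lemma gamma_pdf_x_minus : F (x_minus a) = F n * expR (log_ratio s (-1)).
Proof.
have s2 := sqrt_mode_ge2.
have -> : x_minus a = n + s * -1 by rewrite mulrN1.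
rewrite (gamma_pdfE (n + s * -1)) (gamma_pdfE n) gamma_ker_ratio; last by lra.
exact: mulrAC.
Qed.

(** The two terms of [psi s] are phi_s 1 and phi_s (-1), and ((a - 1) / e)^(a - 1) is the kernel at
    the mode. *)
Lemma A_E : A a = 2 * s * F n + F (x_plus a) - F (x_minus a).
Proof.
have s2 := sqrt_mode_ge2; have n4 := mode_ge4; have nE := sqrt_mode_sqr.
have G0 := gamma_fun_gt0.
rewrite gamma_pdf_x_plus gamma_pdf_x_minus gamma_pdfE /A.
have -> : (n / expR 1) `^ n = K n.
  rewrite gamma_kerE; last by lra.
  rewrite /powR gt_eqF ?divr_gt0 ?expR_gt0//; last by lra.
  by rewrite ln_div ?posrE ?expR_gt0 ?expRK//; [congr expR; ring|lra].
have -> : psi s = expR (log_ratio s 1) - expR (log_ratio s (-1)).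
  have i0 : 0 < s^-1 <= 2^-1 by rewrite invr_gt0 lef_pV2 ?posrE; lra.
  rewrite /psi /log_ratio /powR !mulN1r !mulr1 !mulrN1 opprK !expRD !div1r.
  by rewrite !gt_eqF//; [congr (_ - _); rewrite mulrC|lra..].
by field; rewrite gt_eqF.
Qed.

Lemma A_lt1 : A a < 1.
Proof.
have s2 := sqrt_mode_ge2; have n4 := mode_ge4.
have G0 := gamma_fun_gt0.
have K0 : 0 < K n by apply: gamma_ker_gt0; lra.
rewrite A_E gamma_pdf_x_plus gamma_pdf_x_minus gamma_pdfE.
have gap := ratio_gap s2.
have Gge := gamma_fun_ge.
set d1 := expR _ in gap *; set d2 := expR _ in gap *.
have -> : 2 * s * (K n / gamma_fun a) + K n / gamma_fun a * d1 - K n / gamma_fun a * d2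
   = K n * (2 * s + (d1 - d2)) / gamma_fun a by field; rewrite gt_eqF.
rewrite ltr_pdivrMr// mul1r; apply: lt_le_trans Gge.
rewrite -[X in _ < X]mulrA ltr_pM2l//; lra.
Qed.

End gamma_kernel.

(** * Acceptance probabilities *)

Section pieces.
Context {R : realType}.
Local Notation mu := (@lebesgue_measure R).
Local Notation u01 := (uniform_prob (@ltr01 R)).
Local Open Scope ereal_scope.

(** The sampler's pieces are closed and share endpoints; this makes them disjoint before they are
    glued. *)
Lemma integral_setI_bndo_bndc (B : set R) (f : R -> \bar R) (i : itv_bound R) (r : R) :
  measurable B -> measurable_fun setT f ->
  \int[mu]_(x in [set` Interval i (BLeft r)] `&` B) f x =
  \int[mu]_(x in [set` Interval i (BRight r)] `&` B) f x.
Proof.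
move=> mB mf; rewrite integral_mkcondr [RHS]integral_mkcondr integral_itv_bndo_bndc//.
apply: measurable_funTS; apply/(measurable_restrictT _ _).1 => //.
exact: measurable_funTS.
Qed.

Lemma integral_uniform01_setI (f : R -> \bar R) :
  measurable_fun setT f -> (forall x, 0 <= f x) ->
  \int[u01]_x f x = \int[mu]_(x in `[0%R, 1%R]) f x.
Proof. by move=> mf f0; rewrite integral_uniform// subr0 invr1 mul1e. Qed.

(* The conditional law, given the proposal y = T u, of an acceptance test of the
   form V c(y) <= d(y). *)
Lemma uniform01_acceptance (T c d : R -> R) (B : set R) :
  measurable B -> measurable_fun setT T -> measurable_fun setT c ->
  measurable_fun setT d ->
  (forall u, (0 <= u <= 1)%R -> (0 < c (T u))%R /\ (0 <= d (T u) <= c (T u))%R) ->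
  (u01 \x u01) [set uv | (uv.2 * c (T uv.1) <= d (T uv.1))%R /\ B (T uv.1)] =
  \int[mu]_(u in `[0%R, 1%R] `&` T @^-1` B) (d (T u) / c (T u))%:E.
Proof.
move=> mB mT mc md h; set C := [set uv | _].
have mTB : measurable (T @^-1` B) by rewrite -[X in measurable X]setTI; exact: mT.
have mcT : measurable_fun setT (c \o T) by exact: measurableT_comp.
have mdT : measurable_fun setT (d \o T) by exact: measurableT_comp.
have mC : measurable C.
  rewrite (_ : C = [set uv | (uv.2 * (c \o T) uv.1 <= (d \o T) uv.1)%R] `&` fst @^-1` (T @^-1` B))//.
  apply: measurableI.
    have mle : measurable_fun setT (fun uv : R * R => uv.2 * (c \o T) uv.1 <= (d \o T) uv.1)%R.
      apply: measurable_fun_ler; last exact: (measurableT_comp mdT measurable_fst).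
      apply: measurable_funM; first exact: measurable_snd.
      exact: (measurableT_comp mcT measurable_fst).
    by have := mle measurableT [set true] I; rewrite setTI.
  by rewrite -[X in measurable X]setTI; exact: measurable_fst.
(* By definition the product measure integrates the mass of the sections. The section at u has mass
   d / c if [T u] lies in [B], and 0 otherwise. *)
transitivity (\int[u01]_u (u01 \o xsection C) u) => //.
rewrite integral_uniform01_setI//; last exact: measurable_fun_xsection.
rewrite [RHS]integral_mkcondr; apply: eq_integral => u; rewrite inE/= in_itv/= => u1.
have [c0 dc] := h u u1.
rewrite patchE; case: ifPn => uB.
  rewrite -uniform_prob01_le//; congr (u01 _); apply/seteqP; split => v /=.
    by rewrite /xsection/= inE => -[].
  by move=> vc; rewrite /xsection/= inE; split => //; exact: set_mem.
rewrite (_ : xsection C u = set0) ?measure0//; apply/seteqP; split => v //=.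
by rewrite /xsection/= inE => -[_ ?]; move: uB; rewrite notin_setE.
Qed.

(** * Exponential proposals in the tails *)

Section tail.
Variables (F : R -> R) (x0 b : R) (B D : set R).
Hypotheses (mF : measurable_fun setT F) (F_ge0 : forall y, (0 <= F y)%R).
Hypotheses (mB : measurable B) (mD : measurable D) (b0 : b != 0%R).
Hypothesis preD : (fun e : R => x0 + e * b)%R @^-1` D = `[0%R, +oo[%classic.
Hypotheses (Fx0 : (0 < F x0)%R).
Hypothesis Fle : forall y, (F y <= F x0 * expR (- (y - x0) / b))%R.

(** The proposal x0 + e b, with e standard exponential, has density exp (- (y - x0) / b) / |b| on
    the ray [D]. Multiplied by the acceptance ratio, this leaves F y / (|b| F x0). The sign of [b]
    is free, so both tails are covered. *)
Lemma tail_piece :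
  (`|b| * F x0)%:E *
  (u01 \x u01) [set uv | (uv.2 * (F x0 * expR (- (x0 + - ln uv.1 * b - x0) / b))
                          <= F (x0 + - ln uv.1 * b))%R /\ B (x0 + - ln uv.1 * b)%R] =
  \int[mu]_(y in D `&` B) (F y)%:E.
Proof.
have mT : measurable_fun setT (fun e : R => x0 + e * b)%R by exact: measurable_affine.
have mln : measurable_fun setT (fun u : R => - ln u)%R.
  by apply: measurable_funN; exact: measurable_ln.
have mc : measurable_fun setT (fun y : R => F x0 * expR (- (y - x0) / b))%R.
  apply: measurable_funM => //; apply: measurableT_comp => //.
  by apply: measurable_funM => //; apply: measurable_funN; exact: measurable_funB.
have mTln : measurable_fun setT (fun u : R => x0 + - ln u * b)%R.
  exact: (measurableT_comp mT mln).
have c0 y : (0 < F x0 * expR (- (y - x0) / b))%R by rewrite mulr_gt0// expR_gt0.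
rewrite (@uniform01_acceptance (fun u : R => x0 + - ln u * b)%R _ F B mB mTln mc mF)//; last first.
  by move=> u _; rewrite c0 F_ge0 Fle.
pose q y := (F y / (F x0 * expR (- (y - x0) / b)))%R.
have mV : measurable_fun setT (fun y : R => (F x0 * expR (- (y - x0) / b))^-1)%R.
  rewrite (_ : (fun y : R => _) = (fun y : R => (F x0)^-1 * expR ((y - x0) / b)))%R.
    apply: measurable_funM => //; apply: measurableT_comp => //.
    by apply: measurable_funM => //; exact: measurable_funB.
  by apply/funext => y; rewrite invfM -expRN mulNr opprK.
have mq : measurable_fun setT q by exact: measurable_funM.
have q0 y : (0 <= q y)%R by rewrite divr_ge0// ltW.
pose h : R -> \bar R := (fun e => (q (x0 + e * b)%R)%:E) \_ ((fun e : R => x0 + e * b)%R @^-1` B).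
have mpre : measurable ((fun e : R => x0 + e * b)%R @^-1` B).
  by rewrite -[X in measurable X]setTI; exact: mT.
have mh : measurable_fun setT h.
  apply/(measurable_restrictT _ _).1 => //; apply: measurable_funTS.
  by apply/measurable_EFinP; exact: (measurableT_comp mq mT).
have h0 e : 0 <= h e by rewrite /h patchE; case: ifP; rewrite ?lee_fin.
have -> : \int[mu]_(u in `[0%R, 1%R] `&` (fun u : R => x0 + - ln u * b)%R @^-1` B)
    (q (x0 + - ln u * b)%R)%:E = \int[u01]_u h (- ln u)%R.
  rewrite integral_uniform01_setI//; last exact: (measurableT_comp mh mln).
  by rewrite integral_mkcondr; apply: eq_integral => u _; rewrite /h !patchE.
rewrite integral_uniform_ln//.
(* The weight exp (- e) cancels the exponential in [q], because (y - x0) / b = e. *)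
transitivity ((`|b| * F x0)%:E *
   \int[mu]_(e in `[0%R, +oo[ `&` (fun e : R => x0 + e * b)%R @^-1` B)
     ((F x0)^-1%:E * (F (x0 + e * b)%R)%:E)).
  congr (_ * _); rewrite [RHS]integral_mkcondr; apply: eq_integral => e _.
  rewrite /h !patchE; case: ifP => _; last by rewrite mul0e.
  rewrite -!EFinM; congr (_%:E); rewrite /q.
  have -> : (- (x0 + e * b - x0) / b = - e)%R by field.
  field; apply/andP; split; first by rewrite gt_eqF.
  by rewrite gt_eqF// expR_gt0.
rewrite [RHS](@ge0_integral_affine _ x0 b b0)//; last 3 first.
- exact: measurableI.
- by apply: measurable_funTS; apply/measurable_EFinP.
- by move=> y _; rewrite lee_fin.
rewrite preimage_setI preD ge0_integralZl//.
- by rewrite muleA -EFinM mulfK// gt_eqF.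
- exact: measurableI.
- by apply: measurable_funTS; apply/measurable_EFinP; exact: (measurableT_comp mF mT).
- by move=> y _; rewrite lee_fin.
- by rewrite lee_fin invr_ge0 ltW.
Qed.

End tail.

(** * Uniform proposals next to the mode *)

Section center.
Variables (F : R -> R) (n b : R) (B D : set R).
Hypotheses (mF : measurable_fun setT F).
Hypotheses (mB : measurable B) (mD : measurable D) (b0 : b != 0%R).
Hypothesis preD : (fun u : R => n + u * b)%R @^-1` D = `[0%R, 1%R]%classic.
Hypothesis Fx0 : (F (n + b) < F n)%R.
Hypothesis Fle : forall y, D y -> (F (n + b) <= F y <= F n)%R.

(** Only the part of [F] above the level F (n + b) is sampled here; the slab below it is left to
    [X_r]. *)
Lemma center_piece :
  (`|b| * (F n - F (n + b)))%:E *
  (u01 \x u01) [set uv | (uv.2 * (F n - F (n + b))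
     <= F (n + uv.1 * b) - F (n + b))%R /\ B (n + uv.1 * b)%R] =
  \int[mu]_(y in D `&` B) (F y - F (n + b))%:E.
Proof.
have mT : measurable_fun setT (fun e : R => n + e * b)%R by exact: measurable_affine.
have md : measurable_fun setT (fun y : R => F y - F (n + b))%R by exact: measurable_funB.
have c0 : (0 < F n - F (n + b))%R by rewrite subr_gt0.
have DT u : (0 <= u <= 1)%R -> D (n + u * b)%R.
  move=> u01; suff : ((fun u : R => n + u * b)%R @^-1` D) u by [].
  by rewrite preD/= in_itv.
rewrite (@uniform01_acceptance (fun u : R => n + u * b)%R (fun=> (F n - F (n + b))%R)
  (fun y : R => F y - F (n + b))%R B)//; last first.
  by move=> u /DT /Fle /andP[F1 F2]; rewrite c0 subr_ge0 F1 lerB.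
have mpre : measurable ((fun e : R => n + e * b)%R @^-1` B).
  by rewrite -[X in measurable X]setTI; exact: mT.
rewrite [RHS](@ge0_integral_affine _ n b b0 (D `&` B))//; last 3 first.
- exact: measurableI.
- by apply: measurable_funTS; apply/measurable_EFinP.
- by move=> y [/Fle/andP[F1 _] _]; rewrite lee_fin subr_ge0.
rewrite preimage_setI preD EFinM -muleA; congr (_ * _).
rewrite -ge0_integralZl//.
- by apply: eq_integral => u _; rewrite -EFinM; congr (_%:E); field; rewrite gt_eqF.
- exact: measurableI.
- apply: measurable_funTS; apply/measurable_EFinP; apply: measurable_funM => //.
  exact: (measurableT_comp md mT).
- move=> y; rewrite /= in_itv/= => -[/DT /Fle/andP[F1 _] _].
  by rewrite lee_fin divr_ge0 ?subr_ge0// -subr_ge0 ltW.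
- by rewrite lee_fin ltW.
Qed.

Lemma uniform01_affine : `|b|%:E * u01 ((fun u : R => n + u * b)%R @^-1` B) = mu (D `&` B).
Proof.
have mT : measurable_fun setT (fun e : R => n + e * b)%R by exact: measurable_affine.
have mpre : measurable ((fun e : R => n + e * b)%R @^-1` B).
  by rewrite -[X in measurable X]setTI; exact: mT.
rewrite (@lebesgue_measure_affine _ n b)//; last exact: measurableI.
congr (_ * _); rewrite preimage_setI preD uniform_prob01_setI// setIC /uniform_prob.
rewrite (eq_integral (fun=> 1)) ?integral_cst ?mul1e//; first exact: measurableI.
move=> u; rewrite inE/= in_itv/= => -[u1 _].
by rewrite /uniform_pdf u1 subr0 invr1.
Qed.

End center.
End pieces.

(** * The pieces of the gamma sampler *)

Section gamma_sampler_pieces.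
Context {R : realType} (a : R) (ha : 5 <= a).
Local Notation mu := (@lebesgue_measure R).
Local Notation u01 := (uniform_prob (@ltr01 R)).
Local Notation s := (sqrt_mode a).
Local Notation n := (a - 1).
Local Notation F := (gamma_pdf a).

Lemma gamma_pdf_gt0 (x : R) : 0 < x -> 0 < F x.
Proof. by move=> x0; rewrite gamma_pdfE divr_gt0 ?gamma_ker_gt0 ?gamma_fun_gt0. Qed.

Lemma gamma_pdf_ge0 (x : R) : 0 <= F x.
Proof. by rewrite gamma_pdfE divr_ge0 ?gamma_ker_ge0// ltW ?gamma_fun_gt0. Qed.

Lemma measurable_gamma_pdf : measurable_fun setT F.
Proof.
rewrite (_ : F = fun x => gamma_ker a x * (gamma_fun a)^-1).
  by apply: measurable_funM => //; exact: measurable_gamma_ker.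
by apply/funext => x; rewrite gamma_pdfE.
Qed.

Lemma integral_gamma_pdf : (\int[mu]_x (F x)%:E = 1)%E.
Proof.
under eq_integral => x _ do rewrite gamma_pdfE EFinM.
rewrite ge0_integralZr//=.
- by rewrite integral_gamma_ker// -EFinM divff// gt_eqF// gamma_fun_gt0.
- by apply/measurable_EFinP; exact: measurable_gamma_ker.
- by move=> x _; rewrite lee_fin gamma_ker_ge0.
- by rewrite lee_fin invr_ge0 ltW// gamma_fun_gt0.
Qed.

Lemma gamma_pdf_tangent (x0 x : R) : 0 < x0 ->
  F x <= F x0 * expR ((x - x0) * (n / x0 - 1)).
Proof.
move=> x00; rewrite (gamma_pdfE a x) (gamma_pdfE a x0) mulrAC.
by rewrite ler_pM2r ?invr_gt0 ?gamma_fun_gt0// gamma_ker_tangent.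
Qed.

(** The slope of the tangent at y has the sign of n - y. The product hypothesis says that x does not
    lie on the mode's side of y, which treats both monotone branches and the case y = n at once. *)
Lemma gamma_pdf_le (x y : R) : 0 < y -> (x - y) * (n - y) <= 0 -> F x <= F y.
Proof.
move=> y0 xy; rewrite (le_trans (gamma_pdf_tangent x y0))//.
rewrite -[leRHS]mulr1 ler_wpM2l ?gamma_pdf_ge0// -[leRHS]expR0 ler_expR.
rewrite (_ : (x - y) * (n / y - 1) = (x - y) * (n - y) / y); last by field; rewrite gt_eqF.
by rewrite pmulr_lle0// invr_gt0.
Qed.

Lemma log_ratio_lt0 (r t : R) : 0 < r -> 0 < r + t -> t != 0 -> log_ratio r t < 0.
Proof.
move=> r0 rt0 t0.
have rt1 : 0 < 1 + t / r by rewrite (_ : 1 + t / r = (r + t) / r) ?divr_gt0//; field; lra.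
have tr0 : t / r != 0 by rewrite mulf_neq0// invr_eq0 gt_eqF.
have l : ln (1 + t / r) < t / r.
  by rewrite -ltr_expR lnK ?posrE//; exact: expR_gt1Dx.
rewrite /log_ratio subr_lt0 (_ : r * t = r ^+ 2 * (t / r)); last by field; lra.
by rewrite ltr_pM2l// exprn_gt0.
Qed.

Lemma gamma_pdf_x_plus_lt : F (n + s) < F n.
Proof.
have s2 := sqrt_mode_ge2 ha; have n4 := mode_ge4 ha.
have := gamma_pdf_x_plus ha; rewrite /x_plus => ->.
have Fn : 0 < F n by apply: gamma_pdf_gt0; lra.
by rewrite -[ltRHS]mulr1 ltr_pM2l// -[ltRHS]expR0 ltr_expR log_ratio_lt0//; lra.
Qed.

Lemma gamma_pdf_x_minus_lt : F (n + - s) < F n.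
Proof.
have s2 := sqrt_mode_ge2 ha; have n4 := mode_ge4 ha.
have := gamma_pdf_x_minus ha; rewrite /x_minus => ->.
have Fn : 0 < F n by apply: gamma_pdf_gt0; lra.
by rewrite -[ltRHS]mulr1 ltr_pM2l// -[ltRHS]expR0 ltr_expR log_ratio_lt0 ?oppr_eq0//; lra.
Qed.

Definition accepted (j : nat) (B : set R) : set (R * R) :=
  [set uv | acceptance a j uv.2 (Y a j uv.1) /\ B (Y a j uv.1)].

Definition rejected (B : set R) : set (R * R) := [set uv | B (X_r a uv.1 uv.2)].

(** Hence x_+ / s = s + 1, the scale of the right exponential proposal. *)
Lemma x_plusE : x_plus a = s * (s + 1).
Proof. by rewrite /x_plus -(sqrt_mode_sqr ha); ring. Qed.

Lemma x_minusE : x_minus a = s * (s - 1).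
Proof. by rewrite /x_minus -(sqrt_mode_sqr ha); ring. Qed.

Variables (B : set R) (mB : measurable B).
Local Open Scope ereal_scope.

(** The slope of log f at x_+ is n / x_+ - 1 = - 1 / (s + 1), so the dominating exponential is the
    tangent line at x_+. Moreover p_1 f(n) = (s + 1) f(x_+), the mass under it. *)
Lemma accepted1 : (p_ a 1 * F n)%:E * (u01 \x u01) (accepted 1 B) =
  \int[mu]_(x in `[x_plus a, +oo[ `&` B) (F x)%:E.
Proof.
have s2 := sqrt_mode_ge2 ha; have n4 := mode_ge4 ha.
have xE := x_plusE; have x0 : (0 < x_plus a)%R by rewrite xE mulr_gt0//; lra.
have Fn : (0 < F n)%R by apply: gamma_pdf_gt0; lra.
have b0 : (s + 1 != 0)%R by rewrite gt_eqF//; lra.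
have pre : (fun e : R => x_plus a + e * (s + 1))%R @^-1` `[x_plus a, +oo[ = `[0%R, +oo[%classic.
  apply/seteqP; split => e /=; rewrite !in_itv/= !andbT lerDl pmulr_lge0//; lra.
have le y : (F y <= F (x_plus a) * expR (- (y - x_plus a) / (s + 1)))%R.
  rewrite (le_trans (gamma_pdf_tangent y x0))//.
  rewrite ler_wpM2l ?gamma_pdf_ge0// ler_expR le_eqVlt; apply/orP; left; apply/eqP.
  by rewrite -{1}(sqrt_mode_sqr ha) xE; field; rewrite !gt_eqF//; lra.
rewrite -(tail_piece measurable_gamma_pdf gamma_pdf_ge0 mB (measurable_itv _) b0 pre
  (gamma_pdf_gt0 x0) le).
congr (_%:E * (u01 \x u01) _).
  rewrite /p_ /g gtr0_norm; last lra.
  by rewrite xE; field; rewrite !gt_eqF//; lra.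
apply/seteqP; rewrite /accepted; split => -[u v] /=;
  rewrite (_ : n + s * (1 + ln (1 / u) * (1 + 1 / s)) =
             x_plus a + - ln u * (s + 1))%R ?ln_div1; (try by rewrite /x_plus; field; lra);
  rewrite (_ : - (x_plus a + - ln u * (s + 1) - x_plus a) * s / x_plus a =
     - (x_plus a + - ln u * (s + 1) - x_plus a) / (s + 1))%R ?mulrA//;
  by rewrite xE; field; rewrite !gt_eqF//; lra.
Qed.

(** The mirror case, with signed scale 1 - s. Proposals may be nonpositive; there f = 0 and the
    acceptance probability is 0. *)
Lemma accepted4 : (p_ a 4 * F n)%:E * (u01 \x u01) (accepted 4 B) =
  \int[mu]_(x in `]-oo, x_minus a] `&` B) (F x)%:E.
Proof.
have s2 := sqrt_mode_ge2 ha; have n4 := mode_ge4 ha.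
have xE := x_minusE; have x0 : (0 < x_minus a)%R by rewrite xE mulr_gt0//; lra.
have Fn : (0 < F n)%R by apply: gamma_pdf_gt0; lra.
have b0 : (1 - s != 0)%R by rewrite lt_eqF//; lra.
have pre : (fun e : R => x_minus a + e * (1 - s))%R @^-1` `]-oo, x_minus a] = `[0%R, +oo[%classic.
  apply/seteqP; split => e /=; rewrite !in_itv/= ?andbT gerDl nmulr_lle0//; lra.
have le y : (F y <= F (x_minus a) * expR (- (y - x_minus a) / (1 - s)))%R.
  rewrite (le_trans (gamma_pdf_tangent y x0))//.
  rewrite ler_wpM2l ?gamma_pdf_ge0// ler_expR le_eqVlt; apply/orP; left; apply/eqP.
  by rewrite -{1}(sqrt_mode_sqr ha) xE; field; apply/and3P; split => //; rewrite gt_eqF//; lra.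
rewrite -(tail_piece measurable_gamma_pdf gamma_pdf_ge0 mB (measurable_itv _) b0 pre
  (gamma_pdf_gt0 x0) le).
congr (_%:E * (u01 \x u01) _).
  rewrite /p_ /g ltr0_norm; last lra.
  by rewrite xE; field; rewrite !gt_eqF//; lra.
apply/seteqP; rewrite /accepted; split => -[u v] /=;
  rewrite (_ : n - s * (1 + ln (1 / u) * (1 - 1 / s)) =
             x_minus a + - ln u * (1 - s))%R ?ln_div1; (try by rewrite /x_minus; field; lra);
  rewrite (_ : - (x_minus a - (x_minus a + - ln u * (1 - s))) * s / x_minus a =
     - (x_minus a + - ln u * (1 - s) - x_minus a) / (1 - s))%R ?mulrA//;
  by rewrite xE; field; apply/and3P; split => //; rewrite gt_eqF//; lra.
Qed.

Lemma accepted2 : (p_ a 2 * F n)%:E * (u01 \x u01) (accepted 2 B) =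
  \int[mu]_(x in `[n, x_plus a] `&` B) (F x - F (x_plus a))%:E.
Proof.
have s2 := sqrt_mode_ge2 ha; have n4 := mode_ge4 ha.
have Fn : (0 < F n)%R by apply: gamma_pdf_gt0; lra.
have s0 : (s != 0)%R by rewrite gt_eqF//; lra.
have pre : (fun u : R => n + u * s)%R @^-1` `[n, x_plus a] = `[0%R, 1%R]%classic.
  apply/seteqP; split => e /=; rewrite !in_itv/= /x_plus lerDl lerD2l.
    by rewrite pmulr_lge0 ?ger_pMl//; lra.
  by rewrite pmulr_lge0 ?ger_pMl//; lra.
have le y : `[n, x_plus a]%classic y -> (F (n + s) <= F y <= F n)%R.
  rewrite /= in_itv/= /x_plus => /andP[ny yx].
  apply/andP; split; apply: gamma_pdf_le; [lra| |lra|by rewrite subrr mulr0].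
  by rewrite mulr_ge0_le0//; lra.
rewrite -(center_piece measurable_gamma_pdf mB (measurable_itv _) s0 pre gamma_pdf_x_plus_lt le).
congr (_%:E * _); rewrite /p_ /g gtr0_norm; last lra.
by rewrite -/(x_plus a); field; rewrite gt_eqF.
Qed.

Lemma accepted3 : (p_ a 3 * F n)%:E * (u01 \x u01) (accepted 3 B) =
  \int[mu]_(x in `[x_minus a, n] `&` B) (F x - F (x_minus a))%:E.
Proof.
have s2 := sqrt_mode_ge2 ha; have n4 := mode_ge4 ha; have nE := sqrt_mode_sqr ha.
have Fn : (0 < F n)%R by apply: gamma_pdf_gt0; lra.
have s0 : (- s != 0)%R by rewrite lt_eqF//; lra.
have x0 : (0 < n - s)%R by rewrite -nE (_ : s ^+ 2 - s = s * (s - 1))%R ?mulr_gt0//; [lra..|ring].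
have pre : (fun u : R => n + u * (- s))%R @^-1` `[x_minus a, n] = `[0%R, 1%R]%classic.
  apply/seteqP; split => e /=; rewrite !in_itv/= /x_minus mulrN gerDl lerD2l lerN2 oppr_le0.
    by rewrite andbC pmulr_lge0 ?ger_pMl//; lra.
  by rewrite andbC pmulr_lge0 ?ger_pMl//; lra.
have le y : `[x_minus a, n]%classic y -> (F (n + - s) <= F y <= F n)%R.
  rewrite /= in_itv/= /x_minus => /andP[xy yn].
  apply/andP; split; apply: gamma_pdf_le; [lra| |lra|by rewrite subrr mulr0].
  by rewrite mulr_le0_ge0//; lra.
rewrite -(center_piece measurable_gamma_pdf mB (measurable_itv _) s0 pre gamma_pdf_x_minus_lt le).
rewrite /accepted /=; under eq_set do rewrite -mulrN.
congr (_%:E * _); rewrite /p_ /g ltr0_norm; last lra.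
by rewrite -/(x_minus a) opprK; field; rewrite gt_eqF.
Qed.

(** The test on V' picks a side with odds f(x_+) : f(x_-), and the point is uniform on that side.
    Scaled by s (f(x_+) + f(x_-)), the law has as density exactly the two slabs missing from the
    central pieces. *)
Lemma rejected_law :
  (s * (F (x_plus a) + F (x_minus a)))%:E * (u01 \x u01) (rejected B) =
  (F (x_plus a))%:E * mu (`[n, x_plus a] `&` B)
  + (F (x_minus a))%:E * mu (`[x_minus a, n] `&` B).
Proof.
have s2 := sqrt_mode_ge2 ha; have n4 := mode_ge4 ha.
have xp0 : (0 < x_plus a)%R by rewrite x_plusE mulr_gt0//; lra.
have xm0 : (0 < x_minus a)%R by rewrite x_minusE mulr_gt0//; lra.
have fp := gamma_pdf_gt0 xp0; have fm := gamma_pdf_gt0 xm0.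
set q := (F (x_plus a) / (F (x_plus a) + F (x_minus a)))%R.
have q0 : (0 <= q)%R by rewrite divr_ge0// ?addr_ge0 ?ltW.
have q1 : (q <= 1)%R by rewrite ler_pdivrMr ?addr_gt0// mul1r lerDl ltW.
have mT (b : R) : measurable ((fun u : R => n + u * b)%R @^-1` B).
  by rewrite -[X in measurable X]setTI; exact: measurable_affine.
have -> : rejected B = ((fun u : R => n + u * s)%R @^-1` B) `*` `]-oo, q] `|`
    ((fun u : R => n + u * (- s))%R @^-1` B) `*` `]q, +oo[.
  apply/seteqP; rewrite /rejected /X_r -/q; split => -[u v] /=; rewrite !in_itv/= andbT.
    by case: ltP => qv h; [right; rewrite mulrN|left].
  by case: ltP => qv [] [] //; rewrite ?mulrN.
have disj : ((fun u : R => n + u * s)%R @^-1` B) `*` `]-oo, q] `&`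
    ((fun u : R => n + u * (- s))%R @^-1` B) `*` `]q, +oo[ = set0.
  rewrite -setXI [X in _ `*` X](_ : _ = set0) ?setX0//.
  by apply/seteqP; split => v //=; rewrite !in_itv/= andbT => -[]; lra.
have mX := measurableX (mT s) (measurable_itv `]-oo, q]).
have mY := measurableX (mT (- s)%R) (measurable_itv `]q, +oo[).
have split : (u01 \x u01) (((fun u : R => n + u * s)%R @^-1` B) `*` `]-oo, q] `|`
    ((fun u : R => n + u * (- s))%R @^-1` B) `*` `]q, +oo[) =
    (u01 \x u01) (((fun u : R => n + u * s)%R @^-1` B) `*` `]-oo, q]) +
    (u01 \x u01) (((fun u : R => n + u * (- s))%R @^-1` B) `*` `]q, +oo[).
  exact: (measureU (u01 \x u01) mX mY disj).
rewrite split !product_measure1E//=.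
have -> : u01 `]-oo, q] = q%:E.
  rewrite uniform_prob01_setI// (_ : _ `&` _ = `[0%R, q]%classic).
    by rewrite uniform_prob01_itv ?subr0.
  apply/seteqP; split => v /=; rewrite !in_itv/=.
    by move=> [-> /andP[-> _]].
  by move=> /andP[-> vq]; rewrite vq (le_trans vq).
have -> : u01 `]q, +oo[ = (1 - q)%:E.
  rewrite uniform_prob01_setI// (_ : _ `&` _ = `]q, 1%R]%classic).
    by rewrite uniform_prob01_itv.
  apply/seteqP; split => v /=; rewrite !in_itv/= andbT.
    by move=> [-> /andP[_ ->]].
  by move=> /andP[qv ->]; rewrite qv ltW// (le_lt_trans q0).
have s0 : (s != 0)%R by rewrite gt_eqF//; lra.
have ns0 : (- s != 0)%R by rewrite oppr_eq0.
rewrite -(@uniform01_affine _ n s B `[n, x_plus a]%classic)//; last first.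
  apply/seteqP; split => e /=; rewrite !in_itv/= /x_plus lerDl lerD2l.
    by rewrite pmulr_lge0 ?ger_pMl//; lra.
  by rewrite pmulr_lge0 ?ger_pMl//; lra.
rewrite -(@uniform01_affine _ n (- s) B `[x_minus a, n]%classic)//; last first.
  apply/seteqP; split => e /=; rewrite !in_itv/= /x_minus mulrN gerDl lerD2l lerN2 oppr_le0.
    by rewrite andbC pmulr_lge0 ?ger_pMl//; lra.
  by rewrite andbC pmulr_lge0 ?ger_pMl//; lra.
rewrite normrN gtr0_norm; last lra.
set P1 := u01 _; set P2 := u01 _.
have P1f : P1 \is a fin_num by exact: (fin_num_measure u01 _ (mT s)).
have P2f : P2 \is a fin_num by exact: (fin_num_measure u01 _ (mT (- s)%R)).
rewrite -(fineK P1f) -(fineK P2f) -!EFinM -!EFinD; congr (_%:E).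
  by rewrite /q; field; rewrite gt_eqF// addr_gt0.
- exact: mT.
- exact: mT.
Qed.

Lemma accepted_rejected :
  (p_ a 1 * F n)%:E * (u01 \x u01) (accepted 1 B)
  + (p_ a 2 * F n)%:E * (u01 \x u01) (accepted 2 B)
  + ((p_ a 3 * F n)%:E * (u01 \x u01) (accepted 3 B)
  + (p_ a 4 * F n)%:E * (u01 \x u01) (accepted 4 B))
  + (s * (F (x_plus a) + F (x_minus a)))%:E * (u01 \x u01) (rejected B)
  = \int[mu]_(x in B) (F x)%:E.
Proof.
rewrite accepted1 accepted2 accepted3 accepted4 rejected_law.
have s2 := sqrt_mode_ge2 ha; have n4 := mode_ge4 ha.
have xp0 : (0 < x_plus a)%R by rewrite x_plusE mulr_gt0//; lra.
have xm0 : (0 < x_minus a)%R by rewrite x_minusE mulr_gt0//; lra.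
have mF : measurable_fun setT (fun x => (F x)%:E).
  by apply/measurable_EFinP; exact: measurable_gamma_pdf.
have F0 x : (0 <= (F x)%:E)%E by rewrite lee_fin gamma_pdf_ge0.
(* Adds the slab of height [c] from the rejected law back to a central piece. *)
have refill (D : set R) (c : R) : measurable D -> (0 <= c)%R ->
    (forall x, D x -> c <= F x)%R ->
    \int[mu]_(x in D `&` B) (F x - c)%:E + c%:E * mu (D `&` B) =
    \int[mu]_(x in D `&` B) (F x)%:E.
  move=> mD c0 cF; have mDB : measurable (D `&` B) by exact: measurableI.
  rewrite -(integral_cst mu mDB) -ge0_integralD//.
  - by apply: eq_integral => x _; rewrite -EFinD subrK.
  - by move=> x [/cF]; rewrite lee_fin subr_ge0.
  - apply: measurable_funTS; apply/measurable_EFinP; apply: measurable_funB => //.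
    exact: measurable_gamma_pdf.
have Dp x : `[n, x_plus a]%classic x -> (F (x_plus a) <= F x)%R.
  rewrite /= in_itv/= /x_plus => /andP[nx xp]; apply: gamma_pdf_le; first lra.
  by rewrite mulr_ge0_le0//; lra.
have Dm x : `[x_minus a, n]%classic x -> (F (x_minus a) <= F x)%R.
  rewrite /= in_itv/= => /andP[xm xn]; apply: gamma_pdf_le; first lra.
  by rewrite mulr_le0_ge0//; lra.
rewrite addeACA -(addeA (\int[mu]_(x in `[x_plus a, +oo[ `&` B) _)).
rewrite (addeAC (\int[mu]_(x in `[x_minus a, n] `&` B) _)).
rewrite (refill _ _ (measurable_itv _) (gamma_pdf_ge0 _) Dp).
rewrite (refill _ _ (measurable_itv _) (gamma_pdf_ge0 _) Dm).
rewrite -!(@integral_setI_bndo_bndc _ B)//.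
have join (i k : itv_bound R) (r : R) : (i <= BLeft r)%O -> (BLeft r <= k)%O ->
    \int[mu]_(x in [set` Interval i (BLeft r)] `&` B) (F x)%:E
    + \int[mu]_(x in [set` Interval (BLeft r) k] `&` B) (F x)%:E
    = \int[mu]_(x in [set` Interval i k] `&` B) (F x)%:E.
  move=> ij jk; rewrite [in RHS](itv_bndbnd_setU ij jk) setIUl ge0_integral_setU//.
  - exact: measurableI.
  - exact: measurableI.
  - exact: measurable_funTS.
  - apply/disj_setPS => x [[/= xij _] [/= xjk _]]; move: xij xjk.
    by rewrite !itv_boundlr => /andP[_ +] /andP[+ _]; rewrite !bnd_simp => /lt_geF ->.
rewrite (addeC (\int[mu]_(x in `[x_plus a, +oo[ `&` B) _)) join; last 2 first.
- by rewrite bnd_simp /x_plus; lra.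
- by [].
rewrite (addeC (\int[mu]_(x in `[x_minus a, n[ `&` B) _)) join; last 2 first.
- by [].
- by rewrite bnd_simp /x_minus; lra.
by rewrite addeC join// set_itvNyy setTI.
Qed.
End gamma_sampler_pieces.

(** * The law of the sampler *)

Section sampler_measurability.
Context {R : realType} (a : R) (ha : 5 <= a).
Local Notation s := (sqrt_mode a).
Local Notation n := (a - 1).
Local Notation F := (gamma_pdf a).

Lemma measurable_Y (j : nat) : measurable_fun setT (Y a j).
Proof.
have mln : measurable_fun setT (fun u : R => ln (1 / u)).
  under eq_fun do rewrite ln_div1.
  by apply: measurable_funN; exact: measurable_ln.
case: j => [|[|[|[|[|j]]]]] /=; first exact: measurable_cst.
- by apply: measurable_funD => //; apply: measurable_funM => //;
    apply: measurable_funD => //; exact: measurable_funM.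
- by apply: measurable_funD => //; exact: measurable_funM.
- by apply: measurable_funB => //; exact: measurable_funM.
- by apply: measurable_funB => //; apply: measurable_funM => //;
    apply: measurable_funD => //; exact: measurable_funM.
- exact: measurable_cst.
Qed.

Lemma measurable_accepted (j : nat) (B : set R) : measurable B ->
  measurable (accepted a j B).
Proof.
move=> mB.
have mYu : measurable_fun setT (fun uv : R * R => Y a j uv.1).
  by apply: (measurableT_comp (measurable_Y j)); exact: measurable_fst.
have mF := measurableT_comp (measurable_gamma_pdf a) mYu.
have macc : measurable_fun setT (fun uv : R * R => acceptance a j uv.2 (Y a j uv.1)).
  case: j mYu mF => [|[|[|[|[|j]]]]] mYu mF /=; first exact: measurable_cst.
  - apply: measurable_fun_ler => //; apply: measurable_funM.
      by apply: measurable_funM => //; exact: measurable_snd.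
    apply: measurableT_comp => //; apply: measurable_funM => //; apply: measurable_funM => //.
    by apply: measurable_funN; exact: measurable_funB.
  - apply: measurable_fun_ler; last exact: measurable_funB.
    by apply: measurable_funM => //; exact: measurable_snd.
  - apply: measurable_fun_ler; last exact: measurable_funB.
    by apply: measurable_funM => //; exact: measurable_snd.
  - apply: measurable_fun_ler => //; apply: measurable_funM.
      by apply: measurable_funM => //; exact: measurable_snd.
    apply: measurableT_comp => //; apply: measurable_funM => //; apply: measurable_funM => //.
    by apply: measurable_funN; exact: measurable_funB.
  - exact: measurable_cst.
rewrite (_ : accepted a j B = (fun uv : R * R => acceptance a j uv.2 (Y a j uv.1)) @^-1` [set true]
    `&` (fun uv : R * R => Y a j uv.1) @^-1` B)//.
by apply: measurableI; rewrite -[X in measurable X]setTI; [exact: macc|exact: mYu].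
Qed.

Lemma measurable_rejected (B : set R) : measurable B -> measurable (rejected a B).
Proof.
move=> mB.
have mX : measurable_fun setT (fun uv : R * R => X_r a uv.1 uv.2).
  apply: measurable_fun_ifT.
  - by apply: measurable_fun_ler => //; exact: measurable_snd.
  - by apply: measurable_funD => //; apply: measurable_funM => //; exact: measurable_fst.
  - by apply: measurable_funB => //; apply: measurable_funM => //; exact: measurable_fst.
by rewrite /rejected -[X in measurable X]setTI; exact: mX.
Qed.

(** Since g(a - 1) = 1, p_1 + p_2 = s + g(x_+) and p_3 + p_4 = s - g(x_-). This makes A p_j / p
    equal to p_j f(n), the weight in the accepted pieces. *)
Lemma p_mode : p a * F n = A a.
Proof.
have s2 := sqrt_mode_ge2 ha; have n4 := mode_ge4 ha.
have Fn : 0 < F n by apply: gamma_pdf_gt0 => //; lra.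
rewrite A_E// /p /p_ /g (x_plusE ha) (x_minusE ha).
by field; rewrite !gt_eqF//; lra.
Qed.

Lemma A_gt0 : 0 < A a.
Proof.
have s2 := sqrt_mode_ge2 ha; have n4 := mode_ge4 ha.
have Fn : 0 < F n by apply: gamma_pdf_gt0 => //; lra.
have Fp : 0 < F (x_plus a) by apply: gamma_pdf_gt0 => //; rewrite /x_plus; lra.
have : F (x_minus a) < F n := gamma_pdf_x_minus_lt ha.
have : 0 <= (s - 2) * F n by rewrite mulr_ge0 ?(ltW Fn)//; lra.
rewrite A_E//; lra.
Qed.

End sampler_measurability.

Lemma fin_num_muleDl4 (R : realDomainType) (x y z w c : \bar R) :
  x \is a fin_num -> y \is a fin_num -> z \is a fin_num -> w \is a fin_num ->
  c \is a fin_num -> (x * c + y * c + (z * c + w * c) = (x + y + (z + w)) * c)%E.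
Proof.
move: x y z w c => [x| |] [y| |] [z| |] [w| |] [c| |]// _ _ _ _ _.
by congr (_%:E); rewrite !mulrDl.
Qed.

Lemma fin_num_add4 (R : realDomainType) (x y z w : \bar R) :
  x \is a fin_num -> y \is a fin_num -> z \is a fin_num -> w \is a fin_num ->
  (x + y + (z + w))%E \is a fin_num.
Proof. by rewrite !fin_numD => -> -> -> ->. Qed.

Lemma fin_num_mule_compl (R : realDomainType) (x c : \bar R) :
  x \is a fin_num -> c \is a fin_num -> (c - x * c = (1 - x) * c)%E.
Proof.
move: x c => [x| |] [c| |]// _ _.
by congr (_%:E); rewrite mulrBl mul1r.
Qed.

Section joint_law.
Context {d} {T : measurableType d} {R : realType} (P : probability T R).
Local Notation u01 := (uniform_prob (@ltr01 R)).
Local Open Scope ereal_scope.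

(** Extends independence of [H] from rectangles to all measurable sets of pairs. It is applied to
    (U, V) with a window event, and to (U', V') with the rejection event. *)
Lemma joint_uniform_law (H : set T) (U V : {RV P >-> R}) : measurable H ->
  (forall B1 B2, measurable B1 -> measurable B2 ->
    P (H `&` (U @^-1` B1 `&` V @^-1` B2)) = P H * (u01 B1 * u01 B2)) ->
  forall C, measurable C ->
    P (H `&` (fun t => (U t, V t)) @^-1` C) = P H * (u01 \x u01) C.
Proof.
move=> mH PE C mC.
have mUV0 : measurable_fun setT (fun t => (U t, V t)).
  by apply/measurable_fun_pairP; split; exact: measurable_funPT.
have mUV : measurable_fun setT
    (fun t => (U t, V t) : (measurableTypeR R * measurableTypeR R)%type) := mUV0.
have mpre : measurable ((fun t => (U t, V t)) @^-1` C).
  by rewrite -[X in measurable X]setTI; exact: mUV.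
have PHf : P H \is a fin_num by exact: fin_num_measure.
(* A null [H] cannot be conditioned on, but then both sides are 0. Otherwise [m] below is the
   conditional law of (U, V) given [H]. *)
have [PH0|PH0] := eqVneq (P H) 0.
  rewrite PH0 mul0e; apply/eqP; rewrite eq_le measure_ge0 andbT -PH0.
  by rewrite le_measure ?inE//; exact: measurableI.
pose r : R := (fine (P H))^-1%R.
have r0 : (0 <= r)%R by rewrite invr_ge0 fine_ge0.
have rE : (r * fine (P H) = 1)%R.
  by rewrite /r mulVf// fine_eq0.
pose m : {measure set (measurableTypeR R * measurableTypeR R) -> \bar R} :=
  mscale (NngNum r0) (pushforward_measure (mrestr P mH) mUV).
have mE X : m X = r%:E * P ((fun t => (U t, V t)) @^-1` X `&` H) by [].
have E : (u01 \x u01) C = m C.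
  apply: product_measure_unique => // B1 B2 mB1 mB2.
  rewrite mE setIC.
  transitivity (r%:E * (P H * (u01 B1 * u01 B2))); first by congr (_ * _); exact: PE.
  by rewrite -[P H in LHS](fineK PHf) muleA -EFinM rE mul1e.
rewrite E mE muleA -[X in _ = X * _ * _](fineK PHf) -EFinM.
by rewrite mulrC rE mul1e setIC.
Qed.

End joint_law.

Section sampler_law.
Context {R : realType} (a : R) (ha : 5 <= a).
Context {d : measure_display} {T : measurableType d} (P : probability T R).
Variables (W U V U' V' : {RV P >-> R}) (J : {RV P >-> nat}).
Hypotheses (hW : uniform01 W) (hU : uniform01 U) (hV : uniform01 V).
Hypotheses (hU' : uniform01 U') (hV' : uniform01 V').
Hypothesis J_range : forall t : T, (1 <= J t <= 4)%N.
Hypothesis hJ : forall j : nat, (1 <= j <= 4)%N ->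
  P [set t | J t = j] = (p_ a j / p a)%:E.
Hypothesis hindep : mutually_independent P
  [:: generated_sigma_algebra W; generated_sigma_algebra U;
      generated_sigma_algebra V; generated_sigma_algebra J;
      generated_sigma_algebra U'; generated_sigma_algebra V'].
Local Notation mu := (@lebesgue_measure R).
Local Notation u01 := (uniform_prob (@ltr01 R)).
Local Notation n := (a - 1).
Local Notation F := (gamma_pdf a).
Local Open Scope ereal_scope.

(** Independence is taken over the full index set; [setT] in some slots then gives the subfamilies.
    The factors are grouped as window, proposal pair and fallback pair. *)
Lemma independent6 (BW BU BV BU' BV' : set R) (BJ : set nat) :
  measurable BW -> measurable BU -> measurable BV -> measurable BU' -> measurable BV' ->
  P (W @^-1` BW `&` J @^-1` BJ `&` (U @^-1` BU `&` V @^-1` BV)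
     `&` (U' @^-1` BU' `&` V' @^-1` BV')) =
  u01 BW * P (J @^-1` BJ) * (u01 BU * u01 BV) * (u01 BU' * u01 BV').
Proof.
move=> mW mU mV mU' mV'.
pose E := [:: W @^-1` BW; U @^-1` BU; V @^-1` BV; J @^-1` BJ; U' @^-1` BU'; V' @^-1` BV'].
have := @hindep [set: 'I_6]%SET (fun i => nth set0 E i).
have -> : \bigcap_(i in [set` [set: 'I_6]%SET]) nth set0 E i =
    W @^-1` BW `&` J @^-1` BJ `&` (U @^-1` BU `&` V @^-1` BV)
     `&` (U' @^-1` BU' `&` V' @^-1` BV').
  apply/seteqP; split => t /=.
    move=> H; have h k (kn : (k < 6)%N) : nth set0 E k t.
      by apply: (H (Ordinal kn)); rewrite /= inE.
    by move: (h 0%N isT) (h 1%N isT) (h 2%N isT) (h 3%N isT) (h 4%N isT) (h 5%N isT).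
  by move=> [[[? ?] [? ?]] [? ?]] [[|[|[|[|[|[|//]]]]]] ?].
move=> -> //; last first.
  move=> [[|[|[|[|[|[|//]]]]]] ?] _ /=; rewrite /generated_sigma_algebra.
  - by exists BW => //; rewrite setTI.
  - by exists BU => //; rewrite setTI.
  - by exists BV => //; rewrite setTI.
  - by exists BJ => //; rewrite setTI.
  - by exists BU' => //; rewrite setTI.
  - by exists BV' => //; rewrite setTI.
rewrite (eq_bigl xpredT) => [|i]; last by rewrite inE.
rewrite !big_ord_recl big_ord0 /= mule1.
rewrite -(hW mW) -(hU mU) -(hV mV) -(hU' mU') -(hV' mV').
have mule_perm (w u v j x y : \bar R) :
    w * (u * (v * (j * (x * y)))) = w * j * (u * v) * (x * y).
  by rewrite !muleA (muleAC (w * u)) (muleAC w).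
exact: mule_perm.
Qed.

Lemma uniform01_window : u01 `[(1 - A a)%R, +oo[ = (A a)%:E.
Proof.
have A0 := A_gt0 ha; have A1 := A_lt1 ha.
rewrite uniform_prob01_setI// (_ : _ `&` _ = `[(1 - A a)%R, 1%R]%classic).
  by rewrite uniform_prob01_itv; [congr (_%:E); lra|lra..].
apply/seteqP; split => v /=; rewrite !in_itv/= andbT.
  by move=> [-> /andP[_ ->]].
by move=> /andP[qv ->]; rewrite qv (le_trans _ qv)//; lra.
Qed.

Lemma product_uniform_setT : (u01 \x u01) [set: R * R] = 1.
Proof.
have uT : u01 setT = 1 by exact: (@probability_setT _ _ _ u01).
rewrite -setXTT; transitivity (u01 setT * u01 setT); first exact: product_measure1E.
by rewrite uT mule1.
Qed.

Definition window_event (j : nat) : set T :=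
  W @^-1` `[(1 - A a)%R, +oo[ `&` J @^-1` [set j].

Definition accept_event (B : set R) : set T :=
  [set t | (1 - A a <= W t)%R /\ accepted a (J t) B (U t, V t)].

(** Fixing the index turns acceptance into a condition on (U, V) alone, independent of the
    window. *)
Definition accept_part (j : nat) (B : set R) : set T :=
  window_event j `&` (fun t => (U t, V t)) @^-1` (accepted a j B).

Definition accept_prob (B : set R) : \bar R :=
  (p_ a 1 * F n)%:E * (u01 \x u01) (accepted a 1 B)
  + (p_ a 2 * F n)%:E * (u01 \x u01) (accepted a 2 B)
  + ((p_ a 3 * F n)%:E * (u01 \x u01) (accepted a 3 B)
  + (p_ a 4 * F n)%:E * (u01 \x u01) (accepted a 4 B)).

Lemma measurable_window_event (j : nat) : measurable (window_event j).
Proof.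
apply: measurableI; rewrite -[X in measurable X]setTI.
  exact: (@measurable_funPT _ _ _ _ W).
exact: (@measurable_funPT _ _ _ _ J).
Qed.

Lemma accept_eventE (B : set R) : accept_event B =
  accept_part 1 B `|` accept_part 2 B `|` (accept_part 3 B `|` accept_part 4 B).
Proof.
apply/seteqP; split => t; rewrite /accept_event /accept_part /window_event/= !in_itv/= !andbT.
  move=> [Wt]; have := J_range t.
  case: (J t) => [|[|[|[|[|j]]]]]// _ acc; [left; left|left; right|right; left|right; right];
  by split.
by move=> [[|]|[|]] [[Wt ->] acc].
Qed.

Lemma measurable_preim2 (X Z : {RV P >-> R}) (C : set (R * R)) :
  measurable C -> measurable ((fun t => (X t, Z t)) @^-1` C).
Proof.
move=> mC; rewrite -[X in measurable X]setTI.
have m : measurable_fun setT (fun t => (X t, Z t)).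
  by apply/measurable_fun_pairP; split; exact: measurable_funPT.
exact: m.
Qed.

Lemma measurable_accept_part (j : nat) (B : set R) : measurable B ->
  measurable (accept_part j B).
Proof.
move=> mB; apply: measurableI; first exact: measurable_window_event.
by apply: measurable_preim2; exact: measurable_accepted.
Qed.

Lemma accept_part_law (j : nat) (B B1 B2 : set R) : (1 <= j <= 4)%N ->
  measurable B -> measurable B1 -> measurable B2 ->
  P (accept_part j B `&` (U' @^-1` B1 `&` V' @^-1` B2)) =
  (p_ a j * F n)%:E * (u01 \x u01) (accepted a j B) * (u01 B1 * u01 B2).
Proof.
move=> j4 mB mB1 mB2.
have A0 := A_gt0 ha; have pF := p_mode ha.
have p0 : (p a != 0)%R by apply: contraPneq A0 => p0; rewrite -pF p0 mul0r ltxx.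
(* The rectangle in (U', V') is put into the conditioning event, so that it survives the passage to
   general sets of (U, V). *)
pose H := window_event j `&` (U' @^-1` B1 `&` V' @^-1` B2).
have mRV (X : {RV P >-> R}) (D : set R) : measurable D -> measurable (X @^-1` D).
  by move=> mD; rewrite -[X in measurable X]setTI; exact: measurable_funPT.
have mH : measurable H.
  by apply: measurableI; [exact: measurable_window_event|apply: measurableI; exact: mRV].
have PH D1 D2 : measurable D1 -> measurable D2 ->
    P (H `&` (U @^-1` D1 `&` V @^-1` D2)) =
    (p_ a j * F n)%:E * (u01 D1 * u01 D2) * (u01 B1 * u01 B2).
  move=> mD1 mD2; rewrite /H setIAC independent6//.
  have -> : P (J @^-1` [set j]) = (p_ a j / p a)%:E by rewrite -hJ.
  rewrite uniform01_window -EFinM; congr (_%:E * _ * _).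
  by rewrite -pF; field.
have uT : u01 setT = 1 by exact: (@probability_setT _ _ _ u01).
have PHE : P H = (p_ a j * F n)%:E * (u01 B1 * u01 B2).
  by have := PH setT setT measurableT measurableT; rewrite !preimage_setT setTI setIT uT !mule1.
transitivity (P (H `&` (fun t => (U t, V t)) @^-1` accepted a j B)).
  by rewrite /accept_part /H setIAC.
rewrite (@joint_uniform_law _ _ _ P H U V mH).
- by rewrite PHE muleAC.
- by move=> D1 D2 mD1 mD2; rewrite PH// PHE muleAC.
- exact: measurable_accepted.
Qed.

Lemma product_uniform_fin_num (C : set (R * R)) : measurable C ->
  (u01 \x u01) C \is a fin_num.
Proof.
move=> mC; have C1 : (u01 \x u01) C <= 1.
  rewrite -product_uniform_setT.
  by apply: (@le_measure _ _ _ (u01 \x u01)); rewrite ?inE.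
have C0 : 0 <= (u01 \x u01) C := measure_ge0 (u01 \x u01) C.
by rewrite ge0_fin_numE// (le_lt_trans C1) ?ltry.
Qed.

Lemma accepted_fin_num (j : nat) (B : set R) : measurable B ->
  (p_ a j * F n)%:E * (u01 \x u01) (accepted a j B) \is a fin_num.
Proof.
move=> mB; apply: fin_numM => //.
by apply: product_uniform_fin_num; exact: measurable_accepted.
Qed.

(** The factorisation shows that acceptance is independent of (U', V'), and with B1 = B2 = [setT] it
    identifies [accept_prob B] as the probability of [accept_event B]. *)
Lemma accept_event_law (B B1 B2 : set R) :
  measurable B -> measurable B1 -> measurable B2 ->
  P (accept_event B `&` (U' @^-1` B1 `&` V' @^-1` B2)) =
  accept_prob B * (u01 B1 * u01 B2).
Proof.
move=> mB mB1 mB2.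
have mRV (X : {RV P >-> R}) (D : set R) : measurable D -> measurable (X @^-1` D).
  by move=> mD; rewrite -[X in measurable X]setTI; exact: measurable_funPT.
set Q := U' @^-1` B1 `&` V' @^-1` B2.
have mQ : measurable Q by apply: measurableI; exact: mRV.
have m j : measurable (accept_part j B `&` Q).
  by apply: measurableI => //; exact: measurable_accept_part.
have disj t i j : (accept_part i B `&` Q) t -> (accept_part j B `&` Q) t -> i = j.
  by move=> [[[_ <-] _] _] [[[_ <-] _] _].
have PU (D E : set T) : measurable D -> measurable E -> D `&` E = set0 ->
    P (D `|` E) = P D + P E by move=> mD mE; exact: measureU.
have djoint i j : i != j -> (accept_part i B `&` Q) `&` (accept_part j B `&` Q) = set0.
  by move=> ij; apply/seteqP; split => t // [h1 h2]; rewrite (disj _ _ _ h1 h2) eqxx in ij.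
rewrite accept_eventE !setIUl PU; last 3 first.
- exact: measurableU.
- exact: measurableU.
- by rewrite setIUr !setIUl !djoint ?setU0.
rewrite PU ?djoint// PU ?djoint//.
rewrite !accept_part_law// /accept_prob.
have fin j := accepted_fin_num j mB.
have uf : u01 B1 * u01 B2 \is a fin_num.
  apply: fin_numM; first exact: (fin_num_measure u01 _ mB1).
  exact: (fin_num_measure u01 _ mB2).
exact: (fin_num_muleDl4 (fin 1%N) (fin 2%N) (fin 3%N) (fin 4%N) uf).
Qed.

Lemma accept_prob_fin_num (B : set R) : measurable B -> accept_prob B \is a fin_num.
Proof.
move=> mB; exact: (fin_num_add4 (accepted_fin_num 1 mB) (accepted_fin_num 2 mB)
  (accepted_fin_num 3 mB) (accepted_fin_num 4 mB)).
Qed.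

Lemma sampler_has_density :
  has_density P (fun t => sampler a (W t) (U t) (V t) (J t) (U' t) (V' t)) F.
Proof.
set X := fun t => _.
have preE (B : set R) : X @^-1` B = accept_event B `|`
    (~` accept_event setT `&` (fun t => (U' t, V' t)) @^-1` (rejected a B)).
  apply/seteqP; rewrite /X /sampler /accept_event /accepted /rejected; split => t /=.
    case: ifP => [/andP[h1 h2] h|h hB]; first by left.
    by right; split => // -[h1 [h2 _]]; rewrite h1 h2 in h.
  move=> [[h1 [h2 h]]|[h hB]]; first by rewrite h1 h2.
  by case: ifP => // /andP[h1 h2]; exfalso; apply: h; split.
have mA (B : set R) : measurable B -> measurable (accept_event B).
  move=> mB; rewrite accept_eventE; apply: measurableU; apply: measurableU;
    exact: measurable_accept_part.
have mR (B : set R) : measurable B ->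
    measurable ((fun t => (U' t, V' t)) @^-1` (rejected a B)).
  by move=> mB; apply: measurable_preim2; exact: measurable_rejected.
split.
  move=> _ B mB; rewrite setTI preE; apply: measurableU; first exact: mA.
  by apply: measurableI; [apply: measurableC; exact: mA|exact: mR].
move=> B mB; rewrite preE.
have mRV (Z : {RV P >-> R}) (D : set R) : measurable D -> measurable (Z @^-1` D).
  by move=> mD; rewrite -[X in measurable X]setTI; exact: measurable_funPT.
have uT : u01 setT = 1 by exact: (@probability_setT _ _ _ u01).
have PA D : measurable D -> P (accept_event D) = accept_prob D.
  move=> mD; have := accept_event_law mD measurableT measurableT.
  by rewrite !preimage_setT !setIT uT !mule1.
(* Independence from (U', V') passes to the complement, which makes [X_r] independent of the
   decision to use it. *)
have PC D1 D2 : measurable D1 -> measurable D2 ->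
    P (~` accept_event setT `&` (U' @^-1` D1 `&` V' @^-1` D2)) =
    P (~` accept_event setT) * (u01 D1 * u01 D2).
  move=> mD1 mD2; have mQ : measurable (U' @^-1` D1 `&` V' @^-1` D2).
    by apply: measurableI; exact: mRV.
  have PQ : P (U' @^-1` D1 `&` V' @^-1` D2) = u01 D1 * u01 D2.
    have := @independent6 setT setT setT D1 D2 setT measurableT measurableT measurableT mD1 mD2.
    by rewrite !preimage_setT !setTI uT probability_setT !mul1e.
  have PD (D E : set T) : measurable D -> measurable E ->
      P (D `\` E) = P D - P (D `&` E).
    move=> mD mE; apply: measureD => //.
    by rewrite (le_lt_trans (probability_le1 _ mD))// ltry.
  rewrite setIC -setDE PD//; last exact: mA.
  rewrite [X in _ - P X]setIC (accept_event_law measurableT mD1 mD2) probability_setC ?PA//; last exact: mA.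
  rewrite PQ; have fc := accept_prob_fin_num measurableT.
  have uf : u01 D1 * u01 D2 \is a fin_num.
    apply: fin_numM; first exact: (fin_num_measure u01 _ mD1).
    exact: (fin_num_measure u01 _ mD2).
  exact: fin_num_mule_compl.
have PU (D E : set T) : measurable D -> measurable E -> D `&` E = set0 ->
    P (D `|` E) = P D + P E by move=> mD mE; exact: measureU.
rewrite PU; last 3 first.
- exact: mA.
- by apply: measurableI; [apply: measurableC; exact: mA|exact: mR].
- apply/seteqP; split => t // [[h1 [h2 _]] [h _]]; apply: h; split => //.
rewrite (joint_uniform_law _ PC) ?PA//; last 2 first.
- by apply: measurableC; exact: mA.
- exact: measurable_rejected.
rewrite probability_setC; last exact: mA.
rewrite PA// -(accepted_rejected ha mB) -/(accept_prob B); congr (_ + _ * _).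
(* On the whole line the total is 1 and every pair counts as rejected. Hence the probability of
   rejection is s (f(x_+) + f(x_-)), the weight of [X_r] in [accepted_rejected]. *)
have := accepted_rejected ha (@measurableT _ R).
rewrite -/(accept_prob setT) integral_gamma_pdf// (_ : rejected a setT = setT)//.
rewrite product_uniform_setT mule1.
have fc := accept_prob_fin_num measurableT; rewrite -(fineK fc) -EFinD.
by move=> [<-]; rewrite -EFinB; congr (_%:E); ring.
Qed.

End sampler_law.

Theorem mainTheorem2 (R : realType) (a : R) (ha : 5 <= a) :
  A a < 1 /\
  forall (d : measure_display) (T : measurableType d) (P : probability T R)
    (W U V U' V' : {RV P >-> R}) (J : {RV P >-> nat})
    (hW : uniform01 W) (hU : uniform01 U) (hV : uniform01 V)
    (hU' : uniform01 U') (hV' : uniform01 V')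
    (J_range : forall t : T, (1 <= J t <= 4)%N)
    (hJ : forall j : nat, (1 <= j <= 4)%N ->
      P [set t | J t = j] = (p_ a j / p a)%:E)
    (hindep : mutually_independent P
      [:: generated_sigma_algebra W; generated_sigma_algebra U;
          generated_sigma_algebra V; generated_sigma_algebra J;
          generated_sigma_algebra U'; generated_sigma_algebra V']),
  has_density P
    (fun t => sampler a (W t) (U t) (V t) (J t) (U' t) (V' t))
    (gamma_pdf a).
Proof.
split; first exact: A_lt1.
move=> d T P W U V U' V' J hW hU hV hU' hV' J_range hJ hindep.
exact: sampler_has_density.
Qed.
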